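(* Under Assumptions 1 and 2 (stated in the context), $$\inf_{K\in\mathcal{K}_\beta}J_{\mathrm{mix}}(K)=\min_{(\gamma,X,Y)\in\mathcal{F}_{\mathrm{cvx}}}\gamma,$$ where the minimum on the right-hand side is attained.
   Context: Let $A\in\mathbb{R}^{n\times n}$, $B\in\mathbb{R}^{n\times m}$, $B_w\in\mathbb{R}^{n\times n}$, $W:=B_wB_w^{\mathsf T}$. Let $Q_2\succeq0$, $R_2\succ0$, $Q_\infty\succ0$, $R_\infty\succ0$ be symmetric weight matrices and $\beta>0$. For $K\in\mathbb{R}^{m\times n}$ write $A_K:=A+BK$, $S_K:=Q_\infty+K^{\mathsf T}R_\infty K$. Let $\mathcal{K}:=\{K: A_K \text{ Hurwitz}\}$, $\mathbf{T}_\infty(K)(s)=\begin{bmatrix}Q_\infty^{1/2}\\ R_\infty^{1/2}K\end{bmatrix}(sI-A_K)^{-1}B_w$, $\mathcal{K}_\beta:=\{K\in\mathcal{K}:\|\mathbf{T}_\infty(K)\|_{\mathcal{H}_\infty}<\beta\}$. For $K\in\mathcal{K}_\beta$ let $X_K$ be the unique stabilizing solution (i.e. $A_K+\beta^{-2}X_KS_K$ Hurwitz) of $A_KX+XA_K^{\mathsf T}+\beta^{-2}XS_KX+W=0$ and $J_{\mathrm{mix}}(K):=\operatorname{tr}((Q_2+K^{\mathsf T}R_2K)X_K)$. $\mathcal{F}_{\mathrm{cvx}}:=\{(\gamma,X,Y):\gamma\in\mathbb{R},X\succ0,Y\in\mathbb{R}^{m\times n},\ \mathbb{F}_{\mathrm{cvx}}(X,Y)\preceq0,\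 \gamma\ge\operatorname{tr}(Q_2X)+\operatorname{tr}(R_2YX^{-1}Y^{\mathsf T})\}$, where $\mathbb{F}_{\mathrm{cvx}}(X,Y):=\begin{bmatrix}AX+XA^{\mathsf T}+BY+Y^{\mathsf T}B^{\mathsf T}+W & XQ_\infty^{1/2} & Y^{\mathsf T}R_\infty^{1/2}\\ Q_\infty^{1/2}X & -\beta^2I & 0\\ R_\infty^{1/2}Y & 0 & -\beta^2I\end{bmatrix}$. Assumption 1: $(A,B)$ stabilizable, $(Q_2^{1/2},A)$ detectable, and $\beta>\inf_{K\in\mathcal{K}}\|\mathbf{T}_\infty(K)\|_{\mathcal{H}_\infty}$. Assumption 2: $Q_2\succeq0$ and $W,Q_\infty,R_2,R_\infty$ positive definite. *)

(* Defs.v *)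
From mathcomp Require Import all_boot all_order all_algebra.
From mathcomp Require Import complex.
From mathcomp Require Import all_classical all_reals ereal.

Set Implicit Arguments.
Unset Strict Implicit.
Unset Printing Implicit Defensive.

Import Order.TTheory GRing.Theory Num.Theory.
Local Open Scope ring_scope.

Section MixedH2Hinf.
Variable R : realType.

Definition toC (x : R) : R[i] := Complex x 0.
Definition mxC (p q : nat) (M : 'M[R]_(p, q)) : 'M[R[i]]_(p, q) := map_mx toC M.

Definition hurwitz (k : nat) (M : 'M[R]_k) : Prop :=
  forall l : R[i], eigenvalue (mxC M) l -> complex.Re l < 0.

Definition stabilizable (k p : nat) (A : 'M[R]_k) (B : 'M[R]_(k, p)) : Prop :=
  exists K : 'M[R]_(p, k), hurwitz (A + B *m K).

Definition detectable (p k : nat) (C : 'M[R]_(p, k)) (A : 'M[R]_k) : Prop :=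
  exists L : 'M[R]_(k, p), hurwitz (A + L *m C).

Definition symmetric (k : nat) (M : 'M[R]_k) : Prop := M^T = M.

Definition qform (k : nat) (M : 'M[R]_k) (x : 'cV[R]_k) : R := (x^T *m M *m x) 0 0.

Definition psd (k : nat) (M : 'M[R]_k) : Prop :=
  symmetric M /\ forall x, 0 <= qform M x.
Definition pd (k : nat) (M : 'M[R]_k) : Prop :=
  symmetric M /\ forall x, x != 0 -> 0 < qform M x.
Definition nsd (k : nat) (M : 'M[R]_k) : Prop := psd (- M).

Definition sqrtm (k : nat) (M : 'M[R]_k) : 'M[R]_k :=
  xget 0 [set S | psd S /\ S *m S = M].

Definition cnorm2 (k : nat) (v : 'cV[R[i]]_k) : R :=
  \sum_i (complex.Re (v i 0) ^+ 2 + complex.Im (v i 0) ^+ 2).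

Variables (n m : nat) (A : 'M[R]_n) (B : 'M[R]_(n, m)) (Bw : 'M[R]_n)
  (Q2 Qinf : 'M[R]_n) (R2 Rinf : 'M[R]_m) (beta : R).

Definition AK (K : 'M[R]_(m, n)) : 'M[R]_n := A + B *m K.
Definition SK (K : 'M[R]_(m, n)) : 'M[R]_n := Qinf + K^T *m Rinf *m K.
Definition Wmat : 'M[R]_n := Bw *m Bw^T.

Definition Tinf (K : 'M[R]_(m, n)) (w : R) : 'M[R[i]]_(n + m, n) :=
  mxC (col_mx (sqrtm Qinf) (sqrtm Rinf *m K))
  *m invmx ((Complex 0 w)%:M - mxC (AK K)) *m mxC Bw.

(* H_inf norm: sup over frequencies of the largest singular value *)
Definition hinf_norm (K : 'M[R]_(m, n)) : \bar R :=
  ereal_sup [set y | exists (w : R) (v : 'cV[R[i]]_n),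
     v != 0 /\ y = (Num.sqrt (cnorm2 (Tinf K w *m v) / cnorm2 v))%:E].

Definition Kstab : set 'M[R]_(m, n) := [set K | hurwitz (AK K)].
Definition Kbeta : set 'M[R]_(m, n) :=
  [set K | hurwitz (AK K) /\ (hinf_norm K < beta%:E)%E].

Definition stab_sol (K : 'M[R]_(m, n)) (X : 'M[R]_n) : Prop :=
  symmetric X /\
  AK K *m X + X *m (AK K)^T + beta^-2 *: (X *m SK K *m X) + Wmat = 0 /\
  hurwitz (AK K + beta^-2 *: (X *m SK K)).

Definition XK (K : 'M[R]_(m, n)) : 'M[R]_n := xget 0 [set X | stab_sol K X].

Definition Jmix (K : 'M[R]_(m, n)) : R := \tr ((Q2 + K^T *m R2 *m K) *m XK K).

Definition Fcvx_mx (X : 'M[R]_n) (Y : 'M[R]_(m, n)) : 'M[R]_(n + (n + m)) :=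
  block_mx (A *m X + X *m A^T + B *m Y + Y^T *m B^T + Wmat)
           (row_mx (X *m sqrtm Qinf) (Y^T *m sqrtm Rinf))
           (col_mx (sqrtm Qinf *m X) (sqrtm Rinf *m Y))
           (block_mx (- beta ^+ 2 *: 1%:M) 0 0 (- beta ^+ 2 *: 1%:M)).

Definition Fcvx (g : R) (X : 'M[R]_n) (Y : 'M[R]_(m, n)) : Prop :=
  pd X /\ nsd (Fcvx_mx X Y) /\
  \tr (Q2 *m X) + \tr (R2 *m Y *m invmx X *m Y^T) <= g.

End MixedH2Hinf.

(* Main.v *)
(* A matrix inequality feasible at (X, Y) is, by Schur complement, the Riccati inequality for
   the gain K = Y X^-1.  A gain in K_beta yields a feasible point (X_K, K X_K) of the convex
   program whose value is J_mix(K).  Conversely, mixing any feasible point with a strictly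
   feasible one (obtained from a gain whose norm is below some beta' < beta) gives a strict
   inequality, hence a gain in K_beta; as X_K is the least solution of the Riccati inequality,
   J_mix(K) is at most the value of the mixed point.  The minimum is attained because the
   quadratic terms with Q_inf, R_inf > 0 bound X and Y, and W > 0 forces X > 0 in the limit,
   once Y X^-1 Y^T is relaxed to a block Z with [Z Y; Y^T X] >= 0.

   The stabilizing solution X_K exists because the Hamiltonian matrix has no eigenvalue on the
   imaginary axis when the norm is below beta: its stable invariant subspace is Lagrangian and
   a graph, as the off-diagonal block beta^-2 S_K is definite.  The same construction applied
   to - X X + M = 0 provides the square roots of positive definite matrices. *)
Require Import Defs.
From mathcomp Require Import all_boot all_order all_algebra.
From mathcomp Require Import complex.
From mathcomp Require Import all_classical all_reals ereal.
From mathcomp Require Import topology normedtype derive.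
From mathcomp Require Import ring lra.
Import Order.TTheory GRing.Theory Num.Theory.
Import numFieldNormedType.Exports.
Local Open Scope ring_scope.

Set Implicit Arguments.
Unset Strict Implicit.
Unset Printing Implicit Defensive.

(** * Quadratic forms *)

Section Dot.
Variable R : realType.

Definition dot k (x y : 'cV[R]_k) : R := (x^T *m y) 0 0.

Lemma dotE k (x y : 'cV[R]_k) : dot x y = \sum_i x i 0 * y i 0.
Proof. by rewrite /dot mxE; apply: eq_bigr => i _; rewrite mxE. Qed.

Lemma dotC k (x y : 'cV[R]_k) : dot x y = dot y x.
Proof. by rewrite !dotE; apply: eq_bigr => i _; rewrite mulrC. Qed.

Lemma dotDr k (x y z : 'cV[R]_k) : dot x (y + z) = dot x y + dot x z.
Proof. by rewrite /dot mulmxDr mxE. Qed.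

Lemma dotDl k (x y z : 'cV[R]_k) : dot (y + z) x = dot y x + dot z x.
Proof. by rewrite dotC dotDr !(dotC x). Qed.

Lemma dotZr k a (x y : 'cV[R]_k) : dot x (a *: y) = a * dot x y.
Proof. by rewrite /dot -scalemxAr mxE. Qed.

Lemma dotZl k a (x y : 'cV[R]_k) : dot (a *: x) y = a * dot x y.
Proof. by rewrite dotC dotZr dotC. Qed.

Lemma dotNr k (x y : 'cV[R]_k) : dot x (- y) = - dot x y.
Proof. by rewrite -scaleN1r dotZr mulN1r. Qed.

Lemma dotNl k (x y : 'cV[R]_k) : dot (- x) y = - dot x y.
Proof. by rewrite dotC dotNr dotC. Qed.

Lemma dot0r k (x : 'cV[R]_k) : dot x 0 = 0.
Proof. by rewrite /dot mulmx0 mxE. Qed.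

Lemma dot0l k (x : 'cV[R]_k) : dot 0 x = 0.
Proof. by rewrite dotC dot0r. Qed.

Definition dotL := (dotDl, dotDr, dotNl, dotNr, dotZl, dotZr, dot0l, dot0r).

Lemma dotMl k l (M : 'M[R]_(k, l)) x y : dot (M *m x) y = dot x (M^T *m y).
Proof. by rewrite /dot trmx_mul mulmxA. Qed.

Lemma dotMr k l (M : 'M[R]_(k, l)) x y : dot x (M *m y) = dot (M^T *m x) y.
Proof. by rewrite dotMl trmxK. Qed.

Lemma dot_ge0 k (x : 'cV[R]_k) : 0 <= dot x x.
Proof. by rewrite dotE; apply: sumr_ge0 => i _; rewrite -expr2 sqr_ge0. Qed.

Lemma dot_eq0 k (x : 'cV[R]_k) : (dot x x == 0) = (x == 0).
Proof.
apply/idP/eqP => [|->]; last by rewrite dot0r.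
rewrite dotE psumr_eq0 => [/allP x0|i _]; last by rewrite -expr2 sqr_ge0.
apply/matrixP => i j; rewrite ord1 mxE; apply/eqP.
by have := x0 i; rewrite mem_index_enum mulf_eq0 orbb; apply.
Qed.

Lemma dot_gt0 k (x : 'cV[R]_k) : (0 < dot x x) = (x != 0).
Proof. by rewrite lt_def dot_ge0 andbT dot_eq0. Qed.

Lemma dot_col_mx k l (a c : 'cV[R]_k) (b d : 'cV[R]_l) :
  dot (col_mx a b) (col_mx c d) = dot a c + dot b d.
Proof. by rewrite /dot tr_col_mx mul_row_col mxE. Qed.

Lemma qformE k (M : 'M[R]_k) x : qform M x = dot x (M *m x).
Proof. by rewrite /qform /dot mulmxA. Qed.

Lemma mx_entry_dot k l (M : 'M[R]_(k, l)) i j :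
  M i j = dot (delta_mx i 0) (M *m delta_mx j 0).
Proof. by rewrite /dot !trmx_delta -rowE -colE !mxE. Qed.

Lemma psdP k (M : 'M[R]_k) :
  psd M <-> M^T = M /\ forall x, 0 <= dot x (M *m x).
Proof. by split=> -[? h]; split=> // x; have := h x; rewrite qformE. Qed.

Lemma pdP k (M : 'M[R]_k) :
  pd M <-> M^T = M /\ forall x, x != 0 -> 0 < dot x (M *m x).
Proof. by split=> -[? h]; split=> // x /h; rewrite qformE. Qed.

Lemma pd_psd k (M : 'M[R]_k) : pd M -> psd M.
Proof.
move=> /pdP[sM h]; apply/psdP; split=> // x.
by have [->|/h/ltW//] := eqVneq x 0; rewrite dot0l.
Qed.

Lemma psdD k (M N : 'M[R]_k) : psd M -> psd N -> psd (M + N).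
Proof.
move=> /psdP[sM hM] /psdP[sN hN]; apply/psdP; split; first by rewrite linearD /= sM sN.
by move=> x; rewrite mulmxDl dotDr addr_ge0.
Qed.

Lemma psdZ k (M : 'M[R]_k) a : 0 <= a -> psd M -> psd (a *: M).
Proof.
move=> a0 /psdP[sM hM]; apply/psdP; split; first by rewrite linearZ /= sM.
by move=> x; rewrite -scalemxAl dotZr mulr_ge0.
Qed.

Lemma psdD_pd k (M N : 'M[R]_k) : psd M -> pd N -> pd (M + N).
Proof.
move=> /psdP[sM hM] /pdP[sN hN]; apply/pdP; split; first by rewrite linearD /= sM sN.
by move=> x /hN; rewrite mulmxDl dotDr; apply: ltr_wpDl.
Qed.

Lemma pdZ k (M : 'M[R]_k) a : 0 < a -> pd M -> pd (a *: M).
Proof.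
move=> a0 /pdP[sM hM]; apply/pdP; split; first by rewrite linearZ /= sM.
by move=> x x0; rewrite -scalemxAl dotZr mulr_gt0 // hM.
Qed.

Lemma pd1 k : pd (1%:M : 'M[R]_k).
Proof. by apply/pdP; split=> [|x]; rewrite ?trmx1 // mul1mx dot_gt0. Qed.

Lemma psd_congr k l (M : 'M[R]_k) (N : 'M[R]_(k, l)) :
  psd M -> psd (N^T *m M *m N).
Proof.
move=> /psdP[sM hM]; apply/psdP; split; first by rewrite !trmx_mul trmxK sM mulmxA.
by move=> x; rewrite -!mulmxA dotMr trmxK.
Qed.

Lemma discriminant_le (a b c : R) :
  (forall t, 0 <= a + 2 * t * b + t ^+ 2 * c) -> 0 <= c -> b ^+ 2 <= a * c.
Proof.
move=> h; rewrite le_eqVlt => /orP[/eqP c0|c0].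
  have [->|b0] := eqVneq b 0; first by rewrite -c0 mulr0 expr0n.
  (* With [c = 0], this [t] gives the polynomial the value [-1]. *)
  have := h (- (a + 1) / (2 * b)); rewrite -c0 mulr0 addr0.
  have -> : 2 * (- (a + 1) / (2 * b)) * b = - (a + 1) by field.
  lra.
have := h (- b / c).
have -> : a + 2 * (- b / c) * b + (- b / c) ^+ 2 * c = (a * c - b ^+ 2) / c.
  by field; rewrite gt_eqF.
by rewrite pmulr_lge0 ?invr_gt0 // subr_ge0.
Qed.

Lemma psd_CS k (P : 'M[R]_k) x y : psd P ->
  dot x (P *m y) ^+ 2 <= dot x (P *m x) * dot y (P *m y).
Proof.
move=> /psdP[sP hP]; apply: discriminant_le => // t.
have := hP (x + t *: y); rewrite mulmxDr -scalemxAr !dotL.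
rewrite (dotC y (P *m x)) dotMl sP; nra.
Qed.

Lemma psd_quad_eq0 k (P : 'M[R]_k) x : psd P -> dot x (P *m x) = 0 -> P *m x = 0.
Proof.
move=> hP x0; apply/eqP; rewrite -dot_eq0; apply/eqP.
have := psd_CS (P *m x) x hP; rewrite x0 mulr0 => h.
by apply/eqP; rewrite -sqrf_eq0 eq_le sqr_ge0 andbT.
Qed.

Lemma quad_bound k (N : 'M[R]_k) :
  exists2 kappa, 0 < kappa & forall x, `|dot x (N *m x)| <= kappa * dot x x.
Proof.
pose C : R := \sum_i \sum_j `|N i j|.
exists (C + 1).
  by apply: ltr_wpDl => //; do 2!apply: sumr_ge0 => ? _.
move=> x.
have xi i : x i 0 ^+ 2 <= dot x x.
  by rewrite dotE (bigD1 i) //= -expr2 lerDl sumr_ge0 // => j _; rewrite -expr2 sqr_ge0.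
apply: (@le_trans _ _ (C * dot x x)); last by rewrite ler_wpM2r ?dot_ge0 ?lerDl.
rewrite dotE mulr_suml; apply: (le_trans (ler_norm_sum _ _ _)).
apply: ler_sum => i _; rewrite mxE mulr_sumr mulr_suml.
apply: (le_trans (ler_norm_sum _ _ _)); apply: ler_sum => j _.
rewrite mulrCA normrM ler_wpM2l // ler_norml.
have := xi i; have := xi j; nra.
Qed.

Lemma quad_ubound k (N : 'M[R]_k) :
  exists2 kappa, 0 < kappa & forall x, dot x (N *m x) <= kappa * dot x x.
Proof.
by have [c c0 h] := quad_bound N; exists c => // x; apply: le_trans (h x); apply: ler_norm.
Qed.

Lemma pd_unit k (P : 'M[R]_k) : pd P -> P \in unitmx.
Proof.
move=> /pdP[sP hP]; rewrite -row_free_unit -kermx_eq0; apply/eqP/row_matrixP => i.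
rewrite row0; apply/eqP; apply: contraT => ni0.
have /hP : (row i (kermx P))^T != 0 by rewrite trmx_eq0.
rewrite dotMr sP -{1}sP -trmx_mul -row_mul mulmx_ker row0 trmx0 dot0l.
by rewrite ltxx.
Qed.

Lemma pd_congr k (M N : 'M[R]_k) : pd M -> N \in unitmx -> pd (N^T *m M *m N).
Proof.
move=> pM uN; apply/pdP; split; first by case/psdP: (psd_congr N (pd_psd pM)).
move=> x x0; rewrite -!mulmxA dotMr trmxK; case/pdP: pM => _; apply.
by apply: contraNneq x0 => e; rewrite -(mulKmx uN x) e mulmx0.
Qed.

Lemma sym_inv k (P : 'M[R]_k) : P^T = P -> (invmx P)^T = invmx P.
Proof. by move=> sP; rewrite trmx_inv sP. Qed.

(** Cauchy-Schwarz for [M] between [x] and [F x] gives [(e |x|^2)^2 <= 4 <x, M F x>^2 <= 4 c <x, M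
    x> |x|^2], where [c] bounds the form of [F^T M F]; hence an explicit coercivity constant. *)
Lemma coercive_of_strict k (M F : 'M[R]_k) e : psd M -> 0 < e ->
  (forall x, 2 * dot x (M *m (F *m x)) <= - e * dot x x) ->
  exists2 d, 0 < d & forall x, d * dot x x <= dot x (M *m x).
Proof.
move=> hM e0 h.
have [c c0 hc] := quad_ubound (F^T *m M *m F).
exists (e ^+ 2 / (4 * c)); first by rewrite divr_gt0 ?exprn_gt0 ?mulr_gt0.
move=> x; have := psd_CS x (F *m x) hM.
have := hc x; have := h x; have := (psdP M).1 hM => -[sM pM]; have := pM x.
rewrite -!mulmxA [dot x (F^T *m _)]dotMr trmxK.
set b := dot x (M *m (F *m x)); set a := dot x (M *m x); set f := dot (F *m x) _.
set s := dot x x; have s0 : 0 <= s := dot_ge0 x.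
move=> a0 hb hf hcs.
rewrite mulrAC ler_pdivrMr ?mulr_gt0 //.
have [->|sn0] := eqVneq s 0; first by rewrite mulr0 mulr_ge0 // mulr_ge0 // ltW.
have {sn0}s0 : 0 < s by rewrite lt_def sn0.
rewrite -(ler_pM2r s0).
have h1 : (e * s) ^+ 2 <= 4 * b ^+ 2.
  have : 0 < e * s by rewrite mulr_gt0.
  move: hb; nra.
have h2 : a * f <= a * (c * s) by rewrite ler_wpM2l.
nra.
Qed.

(** With [F = - P^-1], the hypothesis of [coercive_of_strict] is the identity
    [2 <x, P F x> = - 2 |x|^2]. *)
Lemma pd_lbound k (P : 'M[R]_k) : pd P ->
  exists2 d, 0 < d & forall x, d * dot x x <= dot x (P *m x).
Proof.
move=> hP; apply: (@coercive_of_strict _ _ (- invmx P) 2) => //; first exact: pd_psd.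
by move=> x; rewrite mulNmx mulmxN mulKVmx ?pd_unit // dotNr; lra.
Qed.

End Dot.

(** * Lyapunov's theorem *)

Section Hurwitz.
Variable R : realType.

(** * Real and imaginary parts of complex matrices *)

Definition rmx k l (z : 'M[R[i]]_(k, l)) : 'M[R]_(k, l) := map_mx (@complex.Re R) z.
Definition imx k l (z : 'M[R[i]]_(k, l)) : 'M[R]_(k, l) := map_mx (@complex.Im R) z.

Lemma ReM (a b : R[i]) : complex.Re (a * b) =
  complex.Re a * complex.Re b - complex.Im a * complex.Im b.
Proof. by case: a b => [? ?] []. Qed.

Lemma ImM (a b : R[i]) : complex.Im (a * b) =
  complex.Re a * complex.Im b + complex.Im a * complex.Re b.
Proof. by case: a b => [? ?] []. Qed.

Lemma mxC_real_complex k l (M : 'M[R]_(k, l)) : mxC M = map_mx (real_complex R) M.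
Proof. by []. Qed.

Lemma rmxD k l (y z : 'M[R[i]]_(k, l)) : rmx (y + z) = rmx y + rmx z.
Proof. by apply/matrixP => i j; rewrite !mxE raddfD. Qed.
Lemma imxD k l (y z : 'M[R[i]]_(k, l)) : imx (y + z) = imx y + imx z.
Proof. by apply/matrixP => i j; rewrite !mxE raddfD. Qed.
Lemma rmxN k l (z : 'M[R[i]]_(k, l)) : rmx (- z) = - rmx z.
Proof. by apply/matrixP => i j; rewrite !mxE raddfN. Qed.
Lemma imxN k l (z : 'M[R[i]]_(k, l)) : imx (- z) = - imx z.
Proof. by apply/matrixP => i j; rewrite !mxE raddfN. Qed.
Lemma rmxZ k l a (z : 'M[R[i]]_(k, l)) :
  rmx (a *: z) = complex.Re a *: rmx z - complex.Im a *: imx z.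
Proof. by apply/matrixP => i j; rewrite !mxE ReM. Qed.
Lemma imxZ k l a (z : 'M[R[i]]_(k, l)) :
  imx (a *: z) = complex.Im a *: rmx z + complex.Re a *: imx z.
Proof. by apply/matrixP => i j; rewrite !mxE ImM addrC. Qed.

Lemma rmx_mull k l p (M : 'M[R]_(k, l)) (z : 'M_(l, p)) : rmx (mxC M *m z) = M *m rmx z.
Proof.
apply/matrixP => i j; rewrite !mxE raddf_sum; apply: eq_bigr => h _.
by rewrite !mxE /= ReM /= mul0r subr0.
Qed.
Lemma imx_mull k l p (M : 'M[R]_(k, l)) (z : 'M_(l, p)) : imx (mxC M *m z) = M *m imx z.
Proof.
apply/matrixP => i j; rewrite !mxE raddf_sum; apply: eq_bigr => h _.
by rewrite !mxE /= ImM /= mul0r addr0.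
Qed.
Lemma rmx_mulr k l p (M : 'M[R]_(l, p)) (z : 'M_(k, l)) : rmx (z *m mxC M) = rmx z *m M.
Proof.
apply/matrixP => i j; rewrite !mxE raddf_sum; apply: eq_bigr => h _.
by rewrite !mxE /= ReM /= mulr0 subr0.
Qed.
Lemma imx_mulr k l p (M : 'M[R]_(l, p)) (z : 'M_(k, l)) : imx (z *m mxC M) = imx z *m M.
Proof.
apply/matrixP => i j; rewrite !mxE raddf_sum; apply: eq_bigr => h _.
by rewrite !mxE /= ImM /= mulr0 add0r.
Qed.
Lemma mxC_eq0 k l (z : 'M[R[i]]_(k, l)) : rmx z = 0 -> imx z = 0 -> z = 0.
Proof.
move=> /matrixP r0 /matrixP i0; apply/matrixP => i j.
move: (r0 i j) (i0 i j); rewrite !mxE.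
by case: (z i j) => a b /= -> ->.
Qed.

Lemma cnorm2E k (v : 'cV[R[i]]_k) : cnorm2 v = dot (rmx v) (rmx v) + dot (imx v) (imx v).
Proof.
rewrite /cnorm2 !dotE -big_split /=; apply: eq_bigr => i _.
by rewrite !mxE !expr2.
Qed.

Lemma cnorm2_gt0 k (v : 'cV[R[i]]_k) : v != 0 -> 0 < cnorm2 v.
Proof.
move=> v0; rewrite lt_def cnorm2E addr_ge0 ?dot_ge0 // andbT.
rewrite paddr_eq0 ?dot_ge0 // !dot_eq0; apply: contraNN v0 => /andP[/eqP a /eqP b].
by apply/eqP; apply: mxC_eq0.
Qed.

Lemma hurwitz_tr k (F : 'M[R]_k) : hurwitz F -> hurwitz F^T.
Proof.
move=> h l; have -> : mxC F^T = (mxC F)^T by apply/matrixP => i j; rewrite !mxE.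
rewrite eigenvalue_root_char.
have -> : char_poly (mxC F)^T = char_poly (mxC F).
  rewrite /char_poly -[RHS]det_tr; congr (\det _).
  by apply/matrixP => i j; rewrite !mxE eq_sym.
by rewrite -eigenvalue_root_char; apply: h.
Qed.

Lemma char_poly_split k (M : 'M[R[i]]_k) :
  {rs | char_poly M = \prod_(z <- rs) ('X - z%:P)}.
Proof.
have [rs] := closed_field_poly_normal (char_poly M).
by rewrite (monicP (char_poly_monic M)) scale1r; exists rs.
Qed.

(* With [y = G x], [z = (F - l) y] and [r = - Re l], adding [c |G x|^2] to the
   Lyapunov form changes its derivative by [2 c (- r |y|^2 + Re <y, z>)], which is at most
   [- c r |y|^2 + (c / r) |z|^2]. *)
Lemma lyapunov_along_roots k (F : 'M[R]_k.+1) (rs : seq R[i]) :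
  (forall l, l \in rs -> complex.Re l < 0) ->
  let G := horner_mx (mxC F) (\prod_(z <- rs) ('X - z%:P)) in
  exists Y kappa, [/\ Y^T = Y, 0 < kappa,
    forall x, dot x x <= dot x (Y *m x) &
    forall x, 2 * dot x (Y *m (F *m x)) <= - dot x x +
      kappa * (dot (rmx G *m x) (rmx G *m x) + dot (imx G *m x) (imx G *m x))].
Proof.
elim: rs => [_|l rs IH hrs].
  have [c c0 hc] := quad_ubound F.
  (* Without roots [G = 1], and the error term [(1 + 2 c) |x|^2] absorbs both [2 <x, F x>] and
     [|x|^2]. *)
  exists 1%:M, (1 + 2 * c); split.
  - by rewrite trmx1.
  - by rewrite addr_gt0 // mulr_gt0.
  - by move=> x; rewrite mul1mx.
  - move=> x; rewrite big_nil (rmorph1 (horner_mx (mxC F))).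
    have -> : rmx (1 : 'M[R[i]]_k.+1) = 1%:M.
      by apply/matrixP => i j; rewrite !mxE; case: eqP.
    have -> : imx (1 : 'M[R[i]]_k.+1) = 0.
      by apply/matrixP => i j; rewrite !mxE; case: eqP.
    rewrite !mul1mx mul0mx dot0r; have := hc x; lra.
have l0 : complex.Re l < 0 by apply: hrs; rewrite inE eqxx.
have hrs' l' : l' \in rs -> complex.Re l' < 0.
  by move=> l'rs; apply: hrs; rewrite inE l'rs orbT.
have [Y [kappa [sY k0 hY hd]]] := IH hrs'.
rewrite big_cons rmorphM rmorphB /= horner_mx_X horner_mx_C.
set q := \prod_(z <- rs) _ in hd *; set G := horner_mx (mxC F) q in hd *.
have cG : mxC F *m G = G *m mxC F by exact: comm_mx_horner.
have cr : F *m rmx G = rmx G *m F by rewrite -rmx_mull cG rmx_mulr.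
have ci : F *m imx G = imx G *m F by rewrite -imx_mull cG imx_mulr.
set a := complex.Re l in l0; pose b := complex.Im l.
have -> : (mxC F - l%:M) * G = mxC F *m G - l *: G.
  by rewrite -mul_scalar_mx -mulmxBl.
rewrite rmxD imxD rmxN imxN rmxZ imxZ rmx_mull imx_mull -/a -/b.
move: (rmx G) (imx G) cr ci hd => G1 G2 cr ci hd {cG}.
(* The weight [kappa / - a] makes the gain [- kappa |y|^2] cancel the error term inherited from
   [rs]; what remains is [kappa / a^2] times [|z|^2]. *)
exists (Y + (kappa / - a) *: (G1^T *m G1 + G2^T *m G2)), (kappa / a ^+ 2); split.
- by rewrite linearD linearZ linearD /= !trmx_mul !trmxK sY.
- by rewrite divr_gt0 // exprn_even_gt0 //= lt_eqF.
- move=> x; apply: le_trans (hY x) _.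
  rewrite mulmxDl -scalemxAl mulmxDl -!mulmxA !dotL lerDl mulr_ge0 //.
    by rewrite divr_ge0 ?ltW // oppr_gt0.
  by rewrite (dotMr G1^T) (dotMr G2^T) !trmxK addr_ge0 ?dot_ge0.
- move=> x; have := hd x.
  rewrite !mulmxDl -!scalemxAl !mulmxDl -!mulmxA !(mulmxA _ F) -cr -ci -!mulmxA.
  rewrite !mulNmx !mulmxDl !mulNmx -!scalemxAl.
  rewrite !dotDr dotZr dotDr (dotMr G1^T) (dotMr G2^T) !trmxK.
  set y1 := G1 *m x; set y2 := G2 *m x.
  set z1 := F *m y1 - _; set z2 := F *m y2 - _.
  have -> : F *m y1 = z1 + (a *: y1 - b *: y2) by rewrite subrK.
  have -> : F *m y2 = z2 + (b *: y1 + a *: y2) by rewrite subrK.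
  clearbody y1 y2 z1 z2.
  have := dot_ge0 (- a *: y1 - z1); have := dot_ge0 (- a *: y2 - z2).
  rewrite !dotL (dotC z1 y1) (dotC z2 y2) (dotC y2 y1).
  set s := dot x (Y *m _); set p := dot x x.
  set u1 := dot y1 y1; set u2 := dot y2 y2; set w1 := dot z1 z1; set w2 := dot z2 z2.
  set v1 := dot y1 z1; set v2 := dot y2 z2; set u := dot y1 y2.
  move=> e1 e2 e3.
  (* The terms in [b = Im l] only rotate the pair [(y1, y2)] and cancel. *)
  have -> : s + kappa / - a * (v1 + (a * u1 - b * u) + (v2 + (b * u + a * u2))) =
     s + kappa / - a * (v1 + v2 + a * (u1 + u2)) by ring.
  suff : kappa / - a * (2 * (v1 + v2 + a * (u1 + u2))) <=
         kappa / a ^+ 2 * (w1 + w2) - kappa * (u1 + u2) by lra.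
  have -> : kappa / - a * (2 * (v1 + v2 + a * (u1 + u2))) =
     kappa / a ^+ 2 * (- a * (2 * (v1 + v2 + a * (u1 + u2)))).
    by field; rewrite lt_eqF.
  have -> : kappa / a ^+ 2 * (w1 + w2) - kappa * (u1 + u2) =
     kappa / a ^+ 2 * (w1 + w2 - a ^+ 2 * (u1 + u2)) by field; rewrite lt_eqF.
  rewrite ler_wpM2l ?divr_ge0 ?sqr_ge0 ?(ltW k0) //; lra.
Qed.

(** When [rs] lists all eigenvalues, [G] is the characteristic polynomial evaluated at [F], so the
    error term vanishes by Cayley-Hamilton. *)
Lemma lyapunov_exists k (F : 'M[R]_k) : hurwitz F ->
  exists Y, [/\ Y^T = Y, forall x, dot x x <= dot x (Y *m x) &
    forall x, 2 * dot x (Y *m (F *m x)) <= - dot x x].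
Proof.
case: k F => [|k] F hF.
  exists 0; split=> [|x|x]; first by rewrite trmx0.
    by rewrite (flatmx0 x) !dot0l.
  by rewrite (flatmx0 x) !dot0l mulr0 oppr0.
have [rs ers] := char_poly_split (mxC F).
have hrs l : l \in rs -> complex.Re l < 0.
  by move=> lrs; apply: hF; rewrite eigenvalue_root_char ers root_prod_XsubC.
have [Y [c [sY c0 hY hd]]] := lyapunov_along_roots F hrs.
exists Y; split=> // x; apply: le_trans (hd x) _.
rewrite -ers Cayley_Hamilton.
have -> : rmx (0 : 'M[R[i]]_k.+1) = 0 by apply/matrixP => i j; rewrite !mxE.
have -> : imx (0 : 'M[R[i]]_k.+1) = 0 by apply/matrixP => i j; rewrite !mxE.
by rewrite mul0mx dot0l addr0 mulr0 addr0.
Qed.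

(* Let [Y] be a strict Lyapunov matrix and [t] the least nonnegative number with
   [P + t Y >= 0]; if [t > 0], then [P + t Y] is itself coercive, so [t] can be lowered. *)
Lemma lyapunov_psd k (F P : 'M[R]_k) : hurwitz F -> P^T = P ->
  (forall x, dot x (P *m (F *m x)) <= 0) -> psd P.
Proof.
move=> hF sP hP; have [Y [sY hY hd]] := lyapunov_exists hF.
pose S := [set t : R | 0 <= t /\ forall x, 0 <= dot x (P *m x) + t * dot x (Y *m x)]%classic.
have [c c0 hc] := quad_bound P.
have Sc : S c.
  split=> [|x]; first exact: ltW.
  have := hc x; rewrite ler_norml => /andP[h _].
  have : c * dot x x <= c * dot x (Y *m x) by rewrite ler_wpM2l // ltW.
  lra.
have Sinf : has_inf S by split; [exists c | exists 0 => t []].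
set t := inf S.
have t0 : 0 <= t by apply: lb_le_inf; [exists c | move=> ? []].
have St : S t.
  (* The infimum is attained: a negative value at [x] would persist for the members of [S] close
     enough to [t]. *)
  split=> // x; rewrite leNgt; apply/negP => hx.
  have y0 : 0 <= dot x (Y *m x) by apply: le_trans (hY x); apply: dot_ge0.
  have [y0'|yn0] := eqVneq (dot x (Y *m x)) 0.
    by have [_ /(_ x)] := Sc; move: hx; rewrite y0' !mulr0; lra.
  have yp : 0 < dot x (Y *m x) by rewrite lt_def yn0.
  have [e [[_ /(_ x) he]]] : exists e, S e /\
      e < t + - (dot x (P *m x) + t * dot x (Y *m x)) / dot x (Y *m x).
    have [|e Se le] := @inf_adherent _ S (- (dot x (P *m x) + t * dot x (Y *m x)) / dot x (Y *m x)) _ Sinf.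
      by rewrite divr_gt0 // oppr_gt0.
    by exists e.
  rewrite -ltrBlDl ltr_pdivlMr //; lra.
have [t00|tn0] := eqVneq t 0.
  by apply/psdP; split=> // x; have [_ /(_ x)] := St; rewrite t00 mul0r addr0.
have tp : 0 < t by rewrite lt_def tn0.
have MP : psd (P + t *: Y).
  apply/psdP; split; first by rewrite linearD linearZ /= sP sY.
  by move=> x; rewrite mulmxDl -scalemxAl dotDr dotZr; have [_] := St.
have [x|d d0 hM] := @coercive_of_strict _ _ (P + t *: Y) F t MP tp.
  rewrite mulmxDl -scalemxAl dotDr dotZr.
  have := hP x; have : t * (2 * dot x (Y *m (F *m x))) <= t * - dot x x by rewrite ler_wpM2l.
  lra.
have [e e0 he] := quad_ubound Y.
(* Lowering [t] by [d / e] costs at most [(d / e) <x, Y x> <= d |x|^2], which the coercivity of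
   [P + t Y] pays for. *)
pose t' := Num.max 0 (t - d / e).
have : t <= t'.
  apply: ge_inf; first by exists 0 => ? [].
  split=> [|x]; first by rewrite le_max lexx.
  have := hM x; rewrite mulmxDl -scalemxAl dotDr dotZr.
  have hx : (d / e) * dot x (Y *m x) <= d * dot x x.
    by rewrite mulrAC ler_pdivrMr // -mulrA ler_pM2l // mulrC.
  have y0 : 0 <= dot x (Y *m x) by apply: le_trans (hY x); apply: dot_ge0.
  have : (t - d / e) * dot x (Y *m x) <= t' * dot x (Y *m x).
    by rewrite ler_wpM2r // le_max lexx orbT.
  lra.
rewrite le_max leNgt tp /=; have : 0 < d / e by rewrite divr_gt0.
lra.
Qed.

End Hurwitz.

(** * Stabilizing solutions of the Riccati equation *)

Lemma eigen_horner (K : fieldType) k (G : 'M[K]_k.+1) (u : 'rV_k.+1) l p :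
  u *m G = l *: u -> u *m horner_mx G p = p.[l] *: u.
Proof.
move=> uG; elim/poly_ind: p => [|p c IH]; first by rewrite rmorph0 mulmx0 horner0 scale0r.
rewrite rmorphD rmorphM /= horner_mx_X horner_mx_C mulmxDr mulmxA IH.
by rewrite -scalemxAl uG scalerA mul_mx_scalar -scalerDl hornerMXaddC.
Qed.

Lemma closed_coprimep (K : closedFieldType) (p q : {poly K}) :
  (forall l, root p l -> ~~ root q l) -> coprimep p q.
Proof.
move=> pq; rewrite /coprimep; apply: contraT => /closed_rootP[l].
by rewrite root_gcd => /andP[/pq/negPf->].
Qed.

Section Hamiltonian.
Variable R : realType.

(** Each root is paired with its conjugate, so that the coefficients are real. *)
Definition modpoly (rs : seq R[i]) : {poly R} := \prod_(z <- rs)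
  ('X ^+ 2 - (2 * complex.Re z)%:P * 'X + (complex.Re z ^+ 2 + complex.Im z ^+ 2)%:P).

Lemma map_modpoly rs : map_poly (real_complex R) (modpoly rs) =
  \prod_(z <- rs) (('X - z%:P) * ('X - (conjc z)%:P)).
Proof.
rewrite rmorph_prod; apply: eq_bigr => z _.
rewrite rmorphD rmorphB rmorphXn rmorphM /= map_polyX !map_polyC /=.
have -> : (2 * complex.Re z)%:C%C = z + conjc z.
  by case: z => a b; apply/eqP; rewrite eq_complex /= subrr eqxx andbT; apply/eqP; ring.
have -> : (complex.Re z ^+ 2 + complex.Im z ^+ 2)%:C%C = z * conjc z.
  case: z => a b; apply/eqP; rewrite eq_complex /=.
  by apply/andP; split; apply/eqP; ring.
rewrite polyCD polyCM; ring.
Qed.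

Lemma root_modpoly rs l : root (map_poly (real_complex R) (modpoly rs)) l ->
  exists2 z, z \in rs & complex.Re z = complex.Re l.
Proof.
rewrite map_modpoly; elim: rs => [|z rs IH]; first by rewrite big_nil => /(negP (root1 l)).
rewrite big_cons !rootM !root_XsubC -orbA => /or3P[/eqP->|/eqP->|/IH[z' z'rs e]].
- by exists z; rewrite ?inE ?eqxx.
- by exists z; rewrite ?inE ?eqxx //; case: z.
- by exists z'; rewrite ?inE ?z'rs ?orbT.
Qed.

Lemma coprimep_modpoly (p q : {poly R}) :
  (forall l, root (map_poly (real_complex R) p) l ->
    ~~ root (map_poly (real_complex R) q) l) -> coprimep p q.
Proof. by move=> pq; rewrite -(coprimep_map (real_complex R)); apply: closed_coprimep. Qed.

(** The eigenvalues are sorted by the sign of their real part, and each factor takes the conjugates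
    along to stay real. Then [p q] is a multiple of the characteristic polynomial, and
    Cayley-Hamilton applies. *)
Lemma spectral_split k (G : 'M[R]_k.+1) :
  (forall l, eigenvalue (mxC G) l -> complex.Re l != 0) ->
  exists p q : {poly R}, [/\ horner_mx G (p * q) = 0,
    forall l, root (map_poly (real_complex R) p) l -> complex.Re l < 0 &
    forall l, root (map_poly (real_complex R) q) l -> 0 < complex.Re l].
Proof.
move=> hG; have [rs ers] := char_poly_split (mxC G).
have hrs l : l \in rs -> complex.Re l != 0.
  by move=> lrs; apply: hG; rewrite eigenvalue_root_char ers root_prod_XsubC.
exists (modpoly [seq z <- rs | complex.Re z < 0]).
exists (modpoly [seq z <- rs | ~~ (complex.Re z < 0)]); split.
- apply: (map_mx_inj (f := real_complex R)); rewrite map_horner_mx rmorphM /= map_mx0.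
  have -> : map_poly (real_complex R) (modpoly [seq z <- rs | complex.Re z < 0]) *
      map_poly (real_complex R) (modpoly [seq z <- rs | ~~ (complex.Re z < 0)]) =
      char_poly (mxC G) * \prod_(z <- rs) ('X - (conjc z)%:P).
    rewrite !map_modpoly !big_filter ers -big_split /=.
    by rewrite [RHS](bigID (fun z => complex.Re z < 0)).
  by rewrite rmorphM /= Cayley_Hamilton mul0r.
- by move=> l /root_modpoly[z]; rewrite mem_filter => /andP[zn _] <-.
- move=> l /root_modpoly[z]; rewrite mem_filter => /andP[zn /hrs z0] <-.
  by rewrite lt_def z0 leNgt.
Qed.

(** Moving [J] across one factor [G] turns it into [- G^T]; the induction repeats this for every
    power. *)
Lemma hamiltonian_adjoint k (G J : 'M[R]_k.+1) p : G *m J = - (J *m G^T) ->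
  horner_mx G p *m J = J *m (horner_mx G (p \Po (- 'X)))^T.
Proof.
move=> GJ; elim/poly_ind: p => [|p c IH].
  by rewrite comp_poly0 !rmorph0 trmx0 mul0mx mulmx0.
rewrite comp_polyD comp_polyM comp_polyX comp_polyC.
rewrite (mulrC (p \Po _)) !rmorphD !rmorphM rmorphN /= horner_mx_X horner_mx_C.
rewrite linearD /= trmx_mul tr_scalar_mx linearN /= mulmxDl mulmxDr.
rewrite mul_scalar_mx mul_mx_scalar; congr (_ + _).
by rewrite mulmxA -IH -mulmxA GJ !mulmxN mulmxA.
Qed.

(** Bezout writes [V = V b(G) p(-G)]. In [U J V^T], moving the transposed factor [p(-G)^T] across
    [J] turns it into [p(G)], which kills [U]. *)
Lemma isotropic_ker k (G J : 'M[R]_k.+1) p l (U V : 'M_(l, k.+1)) :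
  G *m J = - (J *m G^T) -> coprimep p (p \Po (- 'X)) ->
  U *m horner_mx G p = 0 -> V *m horner_mx G p = 0 -> U *m J *m V^T = 0.
Proof.
move=> GJ /Bezout_eq1_coprimepP[[/= a b]] ab U0 V0.
have -> : V = V *m horner_mx G b *m horner_mx G (p \Po (- 'X)).
  have := rmorph1 (horner_mx G); rewrite -ab (mulrC a) rmorphD !rmorphM /= => e.
  by rewrite -[LHS]mulmx1 -[1%:M]e mulmxDr !mulmxA V0 mul0mx add0r.
rewrite trmx_mul mulmxA -(mulmxA U) -hamiltonian_adjoint //.
by rewrite mulmxA U0 !mul0mx.
Qed.

(** [Kn] and [Kp] are the stable and unstable spectral subspaces, the kernels of [p(G)] and [q(G)].
    The roots of [p(X)] and [p(-X)] lie in opposite half planes, so these are coprime and [Kn] is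
    isotropic; likewise for [Kp]. *)
Lemma lagrangian_split k (G J : 'M[R]_k) : G *m J = - (J *m G^T) ->
  (forall l, eigenvalue (mxC G) l -> complex.Re l != 0) ->
  exists Kn Kp : 'M[R]_k, [/\ (1%:M <= Kn + Kp)%MS,
    stablemx Kn G /\ stablemx Kp G,
    forall l (U V : 'M_(l, k)), (U <= Kn)%MS -> (V <= Kn)%MS -> U *m J *m V^T = 0,
    forall l (U V : 'M_(l, k)), (U <= Kp)%MS -> (V <= Kp)%MS -> U *m J *m V^T = 0 &
    forall l (U : 'M_(l, k)) (L : 'M_l), (U <= Kn)%MS -> row_free U ->
      U *m G = L *m U -> hurwitz L].
Proof.
case: k G J => [|k] G J GJ hG.
  exists 0, 0; split=> [| |l U V _ _|l U V _ _|l U L _].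
  - by rewrite [1%:M]flatmx0 sub0mx.
  - by rewrite !mul0mx sub0mx.
  - by rewrite (thinmx0 U) !mul0mx.
  - by rewrite (thinmx0 U) !mul0mx.
  rewrite (thinmx0 U) /row_free mxrank0 => /eqP l0 _ z /eigenvalueP[v _].
  by case: l / l0 {U} L v => L v; rewrite (thinmx0 v) eqxx.
have [p [q [pq0 hp hq]]] := spectral_split hG.
have rootN r l : root (map_poly (real_complex R) (r \Po (- 'X))) l =
                 root (map_poly (real_complex R) r) (- l).
  rewrite map_comp_poly rmorphN /= map_polyX /root horner_comp hornerN hornerX.
  by [].
have pq : coprimep p q.
  by apply: coprimep_modpoly => l /hp lp; apply/negP => /hq; rewrite ltNge ltW.
have pp : coprimep p (p \Po (- 'X)).
  apply: coprimep_modpoly => l /hp lp; rewrite rootN; apply/negP => /hp.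
  by rewrite raddfN /= oppr_lt0 ltNge ltW.
have qq : coprimep q (q \Po (- 'X)).
  apply: coprimep_modpoly => l /hq lp; rewrite rootN; apply/negP => /hq.
  by rewrite raddfN /= oppr_gt0 ltNge ltW.
exists (kermx (horner_mx G p)), (kermx (horner_mx G q)); split.
- have := kermxpolyM G pq; rewrite /kermxpoly pq0 => <-.
  by rewrite kermx0.
- by split; apply: comm_mx_stable_ker; apply/comm_mx_sym/comm_mx_horner.
- move=> l U V /sub_kermxP U0 /sub_kermxP V0; exact: (isotropic_ker GJ pp).
- move=> l U V /sub_kermxP U0 /sub_kermxP V0; exact: (isotropic_ker GJ qq).
(* An eigenvector [v] of [L] yields the eigenvector [v U] of [G], on which [p(G)] acts both as
   [p(z)] and as zero. *)
- move=> l U L /sub_kermxP U0 fU UG z /eigenvalueP[v vL v0].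
  apply: hp; rewrite /root.
  have vU0 : v *m mxC U != 0.
    apply: contraNneq v0 => vU; apply/eqP.
    have fUC : row_free (mxC U) by rewrite mxC_real_complex row_free_map.
    by apply: (row_free_inj fUC); rewrite vU mul0mx.
  have eUG : v *m mxC U *m mxC G = z *: (v *m mxC U).
    rewrite -mulmxA !mxC_real_complex -map_mxM UG map_mxM -!mxC_real_complex.
    by rewrite mulmxA vL scalemxAl.
  have := eigen_horner (map_poly (real_complex R) p) eUG.
  have -> : horner_mx (mxC G) (map_poly (real_complex R) p) = mxC (horner_mx G p).
    exact/esym/(map_horner_mx (real_complex R)).
  rewrite -mulmxA !mxC_real_complex -map_mxM U0 map_mx0 mulmx0.
  by move/esym/eqP; rewrite scaler_eq0 (negPf vU0) orbF.
Qed.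

(** * The Hamiltonian matrix of a Riccati equation *)

Variables (n : nat) (A S W : 'M[R]_n).

(** It acts on row vectors: [[1 X] H = (A + X S) [1 X]] is the Riccati equation
    [A X + X A^T + X S X + W = 0]. *)
Definition hamilton : 'M[R]_(n + n) := block_mx A (- W) S (- A^T).
Definition sympl : 'M[R]_(n + n) := block_mx 0 1%:M (- 1%:M) 0.

Lemma hamilton_sympl : S^T = S -> W^T = W ->
  hamilton *m sympl = - (sympl *m hamilton^T).
Proof.
move=> sS sW; rewrite /hamilton /sympl tr_block_mx !mulmx_block opp_block_mx.
rewrite !(mulmx0, mul0mx, mulmx1, mul1mx, mulmxN, mulNmx, add0r, addr0, opprK).
by rewrite !linearN /= trmxK sS sW !opprK.
Qed.

Lemma sympl_row (u1 u2 v1 v2 : 'M[R]_n) :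
  row_mx u1 u2 *m sympl *m (row_mx v1 v2)^T = u1 *m v2^T - u2 *m v1^T.
Proof.
rewrite /sympl mul_row_block tr_row_mx mul_row_col.
by rewrite !(mulmx0, mulmx1, mulmxN, add0r, addr0) mulNmx addrC.
Qed.

Lemma row_hamilton l (u1 u2 : 'M[R]_(l, n)) :
  row_mx u1 u2 *m hamilton = row_mx (u1 *m A + u2 *m S) (- (u1 *m W) - u2 *m A^T).
Proof. by rewrite mul_row_block !mulmxN. Qed.

(* If [(0, u)] lies in an invariant isotropic subspace, so does its image, and isotropy of
   the pair reads [u S u^T = 0]. *)
Lemma isotropic_graph (K : 'M[R]_(n + n)) : S^T = S ->
  (forall x, dot x (S *m x) = 0 -> x = 0) -> stablemx K hamilton ->
  (forall l (U V : 'M_(l, n + n)), (U <= K)%MS -> (V <= K)%MS -> U *m sympl *m V^T = 0) ->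
  forall l (u : 'M_(l, n)), (row_mx 0 u <= K)%MS -> u = 0.
Proof.
move=> sS hS stK iK l u uK; apply/row_matrixP => i; rewrite row0.
set v := row i u.
have vK : (row_mx 0 v <= K)%MS.
  by apply: submx_trans uK; rewrite -(row0 _ _ i) -row_row_mx row_sub.
have vHK : (row_mx 0 v *m hamilton <= K)%MS.
  exact: submx_trans (submxMr _ vK) stK.
have := iK _ _ _ vK vHK; rewrite row_hamilton !mul0mx !add0r.
rewrite /sympl mul_row_block tr_row_mx mul_row_col.
rewrite !(mulmx0, mul0mx, mulmx1, mulmxN, add0r, addr0) => e.
apply: trmx_inj; rewrite trmx0; apply: hS; rewrite /dot trmxK.
move: e; rewrite trmx_mul sS mulNmx => /eqP.
by rewrite oppr_eq0 => /eqP ->; rewrite mxE.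
Qed.

(** A combination of basis rows with vanishing first block has the form [(0, u)], hence is zero:
    projection to the first block is injective on [K]. *)
Lemma isotropic_rank (K : 'M[R]_(n + n)) :
  (forall l (u : 'M_(l, n)), (row_mx 0 u <= K)%MS -> u = 0) ->
  row_free (lsubmx (row_base K)) /\ (\rank K <= n)%N.
Proof.
move=> hK; have fK : row_free (lsubmx (row_base K)).
  rewrite -kermx_eq0; apply/eqP.
  apply: (row_free_inj (row_base_free K)); rewrite mul0mx.
  have e : kermx (lsubmx (row_base K)) *m row_base K =
    row_mx 0 (kermx (lsubmx (row_base K)) *m rsubmx (row_base K)).
    by rewrite -[X in _ *m X = _]hsubmxK mul_mx_row mulmx_ker.
  have /hK z : (row_mx 0 (kermx (lsubmx (row_base K)) *m rsubmx (row_base K)) <= K)%MS.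
    by rewrite -e; apply: submx_trans (submxMl _ _) _; rewrite eq_row_base.
  by rewrite e z row_mx0.
by split=> //; move: fK; rewrite /row_free => /eqP <-; apply: rank_leq_col.
Qed.

Lemma riccati_stabilizing : S^T = S -> W^T = W ->
  (forall x, dot x (S *m x) = 0 -> x = 0) ->
  (forall l, eigenvalue (mxC hamilton) l -> complex.Re l != 0) ->
  exists X, [/\ X^T = X, A *m X + X *m A^T + X *m S *m X + W = 0 &
    hurwitz (A + X *m S)].
Proof.
move=> sS sW hS hH.
have [Kn [Kp [full [stn stp] isn isp hK]]] := lagrangian_split (hamilton_sympl sS sW) hH.
have gn := isotropic_graph sS hS stn isn.
have [fn rn] := isotropic_rank gn.
have [_ rp] := isotropic_rank (isotropic_graph sS hS stp isp).
(* Two subspaces of rank at most [n] that together span [n + n] dimensions both have rank [n]. *)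
have rKn : \rank Kn = n.
  have : (n + n <= \rank Kn + \rank Kp)%N.
    rewrite -[X in (X <= _)%N](mxrank1 R (n + n)).
    by apply: leq_trans (mxrankS full) _; apply: mxrank_adds_leqif.
  move=> h; apply/eqP; rewrite eqn_leq rn -(leq_add2r n).
  by apply: leq_trans h _; rewrite leq_add2l.
have : row_full (lsubmx (row_base Kn)) by rewrite /row_full (eqP fn) rKn.
case/row_fullP => L Lid.
pose X := L *m rsubmx (row_base Kn).
have VK : (row_mx 1%:M X <= Kn)%MS.
  by rewrite -Lid -mul_mx_row hsubmxK -(eq_row_base Kn) submxMl.
have sX : X^T = X.
  have := isn _ _ _ VK VK; rewrite sympl_row trmx1 mul1mx mulmx1 => /eqP.
  by rewrite subr_eq0 => /eqP.
have e1 : row_mx 1%:M X *m hamilton = row_mx (A + X *m S) (- W - X *m A^T).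
  by rewrite row_hamilton !mul1mx.
have e2 : (A + X *m S) *m row_mx 1%:M X = row_mx (A + X *m S) ((A + X *m S) *m X).
  by rewrite mul_mx_row mulmx1.
(* By invariance [Kn] contains the rows of both products, hence of their difference, whose first
   block is zero; [gn] then kills the second block. *)
have e3 : - W - X *m A^T = (A + X *m S) *m X.
  apply/eqP; rewrite -subr_eq0; apply/eqP; apply: gn.
  have -> : row_mx 0 (- W - X *m A^T - (A + X *m S) *m X) =
     row_mx 1%:M X *m hamilton - (A + X *m S) *m row_mx 1%:M X.
    by rewrite e1 e2 opp_row_mx add_row_mx subrr.
  apply: addmx_sub; first exact: submx_trans (submxMr _ VK) stn.
  by rewrite -mulNmx; apply: submx_trans (submxMl _ _) VK.
exists X; split=> //.
  rewrite mulmxDl in e3.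
  by rewrite (addrAC (A *m X)) -e3 subrK addNr.
apply: (hK _ (row_mx 1%:M X)) => //; last by rewrite e1 e2 e3.
apply/row_freeP; exists (col_mx 1%:M 0).
by rewrite mul_row_col mulmx1 mulmx0 addr0.
Qed.

End Hamiltonian.

(** * The bounded real lemma *)

Section BoundedReal.
Variable R : realType.

Lemma hamilton_imag n (A S W : 'M[R]_n) l : S^T = S -> W^T = W ->
  eigenvalue (mxC (hamilton A S W)) l -> complex.Re l = 0 ->
  exists w (x1 x2 y1 y2 : 'cV[R]_n),
    [/\ A^T *m x1 + S *m y1 = - (w *: x2), A^T *m x2 + S *m y2 = w *: x1,
        W *m x1 + A *m y1 = w *: y2 & W *m x2 + A *m y2 = - (w *: y1)] /\
    ~ [/\ x1 = 0, x2 = 0, y1 = 0 & y2 = 0].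
Proof.
move=> sS sW /eigenvalueP[v vH v0] l0.
have er : rmx v *m hamilton A S W = - (complex.Im l *: imx v).
  by rewrite -rmx_mulr vH rmxZ l0 scale0r add0r.
have ei : imx v *m hamilton A S W = complex.Im l *: rmx v.
  by rewrite -imx_mulr vH imxZ l0 scale0r addr0.
exists (complex.Im l), (lsubmx (rmx v))^T, (lsubmx (imx v))^T,
  (rsubmx (rmx v))^T, (rsubmx (imx v))^T.
move: (rmx v) (imx v) (@mxC_eq0 _ _ _ v) er ei => r s vrs er ei.
have : row_mx (lsubmx r) (rsubmx r) *m hamilton A S W =
    - (complex.Im l *: row_mx (lsubmx s) (rsubmx s)) by rewrite !hsubmxK.
have : row_mx (lsubmx s) (rsubmx s) *m hamilton A S W =
    complex.Im l *: row_mx (lsubmx r) (rsubmx r) by rewrite !hsubmxK.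
rewrite !row_hamilton.
rewrite !scale_row_mx !opp_row_mx.
move=> /eq_row_mx[e3 e4] /eq_row_mx[e1 e2]; split.
  split.
  - by apply: trmx_inj; rewrite linearD linearN linearZ /= !trmx_mul !trmxK sS e1.
  - by apply: trmx_inj; rewrite linearD linearZ /= !trmx_mul !trmxK sS e3.
  - apply: trmx_inj; rewrite linearD linearZ /= !trmx_mul !trmxK sW.
    by rewrite -[LHS]opprK opprD e2 opprK.
  - apply: trmx_inj; rewrite linearD linearN linearZ /= !trmx_mul !trmxK sW.
    by rewrite -[LHS]opprK opprD e4.
case=> a b c d; move/eqP: v0; apply; apply: vrs.
  by rewrite -[r]hsubmxK -(trmxK (lsubmx r)) a -(trmxK (rsubmx r)) c !trmx0 row_mx0.
by rewrite -[s]hsubmxK -(trmxK (lsubmx s)) b -(trmxK (rsubmx s)) d !trmx0 row_mx0.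
Qed.

(* A square root of [M] is the stabilizing solution of [- X X + M = 0]. *)
Lemma pd_sqrt n (M : 'M[R]_n) : pd M -> exists X, psd X /\ X *m X = M.
Proof.
move=> /pdP[sM hM].
have [|||l hl|X [sX eX hX]] := @riccati_stabilizing _ _ 0 (- 1%:M) M.
- by rewrite linearN /= trmx1.
- exact: sM.
- by move=> x /eqP; rewrite mulNmx mul1mx dotNr oppr_eq0 dot_eq0 => /eqP.
- apply/eqP => l0.
  have [||w [x1 [x2 [y1 [y2 [[e1 e2 e3 e4]]]]]]] := hamilton_imag _ _ hl l0.
  + by rewrite linearN /= trmx1.
  + exact: sM.
  apply; move: e1 e2 e3 e4; rewrite trmx0 !mul0mx !add0r !mulNmx !mul1mx !addr0.
  move=> /oppr_inj e1 /eqP; rewrite eqr_oppLR => /eqP e2 e3 e4.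
  (* Eliminating [y2] leaves [M x1 = - w^2 x1], impossible for nonzero [x1]; the same goes for
     [x2]. *)
  have x10 : x1 = 0.
    apply/eqP; apply: contraT => /[dup] n0 /hM.
    rewrite e3 e2 dotZr dotNr dotZr mulrN mulrA -expr2.
    by rewrite oppr_gt0 ltNge mulr_ge0 ?sqr_ge0 ?dot_ge0.
  have x20 : x2 = 0.
    apply/eqP; apply: contraT => /[dup] n0 /hM.
    rewrite e4 e1 dotNr !dotZr mulrA -expr2.
    by rewrite oppr_gt0 ltNge mulr_ge0 ?sqr_ge0 ?dot_ge0.
  by rewrite e1 e2 x10 x20 scaler0 oppr0.
have XX : X *m X = M.
  move: eX; rewrite trmx0 mul0mx mulmx0 !add0r mulmxN mulmx1 mulNmx => /eqP.
  by rewrite addrC subr_eq0 => /eqP.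
(* The closed loop matrix is [- X], and [<x, X (- X x)> = - |X x|^2] is the Lyapunov inequality for
   [X]. *)
exists X; split=> //; apply: (lyapunov_psd hX) => // x.
by rewrite add0r mulmxN mulmx1 mulNmx mulmxN dotNr dotMr sX oppr_le0 dot_ge0.
Qed.

Lemma sqrtm_pd n (M : 'M[R]_n) : pd M -> psd (sqrtm M) /\ sqrtm M *m sqrtm M = M.
Proof. by move=> /pd_sqrt hM; exact: (xgetPex 0 hM). Qed.

Lemma hurwitz_unit n (M : 'M[R]_n) l : hurwitz M -> complex.Re l = 0 ->
  l%:M - mxC M \in unitmx.
Proof.
move=> hM l0; rewrite -row_free_unit -kermx_eq0; apply: contraT => /rowV0Pn[v].
move=> /sub_kermxP; rewrite mulmxBr mul_mx_scalar => /eqP.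
rewrite subr_eq0 eq_sym => /eqP vM v0.
have /hM : eigenvalue (mxC M) l by apply/eigenvalueP; exists v.
by rewrite l0 ltxx.
Qed.

Lemma rmx_resolvent n (M : 'M[R]_n) w z :
  rmx (((Complex 0 w)%:M - mxC M) *m z) = - (w *: imx z) - M *m rmx z :> 'cV_n.
Proof.
by rewrite mulmxBl mul_scalar_mx rmxD rmxN rmx_mull rmxZ /= scale0r add0r.
Qed.

Lemma imx_resolvent n (M : 'M[R]_n) w z :
  imx (((Complex 0 w)%:M - mxC M) *m z) = w *: rmx z - M *m imx z :> 'cV_n.
Proof.
by rewrite mulmxBl mul_scalar_mx imxD imxN imx_mull imxZ /= scale0r addr0.
Qed.

Definition cmx k l (a b : 'M[R]_(k, l)) : 'M[R[i]]_(k, l) := \matrix_(i, j) Complex (a i j) (b i j).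

Lemma rmx_cmx k l (a b : 'M[R]_(k, l)) : rmx (cmx a b) = a.
Proof. by apply/matrixP => i j; rewrite !mxE. Qed.
Lemma imx_cmx k l (a b : 'M[R]_(k, l)) : imx (cmx a b) = b.
Proof. by apply/matrixP => i j; rewrite !mxE. Qed.

Lemma mxC_inj k l (y z : 'M[R[i]]_(k, l)) : rmx y = rmx z -> imx y = imx z -> y = z.
Proof.
move=> er ei; apply/eqP; rewrite -subr_eq0; apply/eqP/mxC_eq0.
  by rewrite rmxD rmxN er subrr.
by rewrite imxD imxN ei subrr.
Qed.

Variables (n m : nat) (A : 'M[R]_n) (B : 'M[R]_(n, m)) (Bw : 'M[R]_n)
  (Qinf : 'M[R]_n) (Rinf : 'M[R]_m) (beta : R).
Hypotheses (b0 : 0 < beta) (pW : pd (Wmat Bw)) (pQ : pd Qinf) (pR : pd Rinf).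

Lemma SK_pd K : pd (SK Qinf Rinf K).
Proof.
by rewrite /SK addrC; apply: psdD_pd => //; apply: psd_congr; apply: pd_psd.
Qed.

Lemma dot_W x : dot x (Wmat Bw *m x) = dot (Bw^T *m x) (Bw^T *m x).
Proof. by rewrite /Wmat -mulmxA dotMr. Qed.

(** [SK] is the Gram matrix of the output map of the closed loop. *)
Lemma dot_SK K x : dot x (SK Qinf Rinf K *m x) =
  dot (col_mx (sqrtm Qinf) (sqrtm Rinf *m K) *m x) (col_mx (sqrtm Qinf) (sqrtm Rinf *m K) *m x).
Proof.
have [[/psdP[sq _] eq] [/psdP[sr _] er]] := (sqrtm_pd pQ, sqrtm_pd pR).
rewrite mul_col_mx dot_col_mx [X in _ = X + _]dotMl sq [in RHS]mulmxA eq.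
rewrite -(mulmxA _ K x) [X in _ = _ + X]dotMl sr [X in _ = _ + dot _ X]mulmxA er.
by rewrite /SK mulmxDl dotDr -!mulmxA (dotMr K^T) trmxK.
Qed.

(** An imaginary eigenvalue of the Hamiltonian would supply an input [v] on which the transfer
    matrix has gain exactly [beta] at one frequency, against the norm bound. *)
Lemma stab_sol_exists K : Kbeta A B Bw Qinf Rinf beta K ->
  exists X, stab_sol A B Bw Qinf Rinf beta K X.
Proof.
have aux (a b c d e f s t : R) : a + b = - s -> c + d = t -> e + a = t ->
    f + c = - s -> b + d = e + f by move=> *; lra.
move=> [hK hinf]; have /pdP[sS hS] := SK_pd K; have /pdP[sW hW] := pW.
set S := SK Qinf Rinf K in sS hS *; set W := Wmat Bw in sW hW *.
have b2 : 0 < beta ^+ 2 by rewrite exprn_gt0.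
have b2' : 0 < beta ^- 2 by rewrite invr_gt0.
have sbS : (beta ^- 2 *: S)^T = beta ^- 2 *: S by rewrite linearZ /= sS.
have S0 x : dot x ((beta ^- 2 *: S) *m x) = 0 -> x = 0.
  move=> /eqP; rewrite -scalemxAl dotZr mulf_eq0 gt_eqF //= => /eqP x0.
  by apply/eqP; apply: contraT => /hS; rewrite x0 ltxx.
have W0 x : dot x (W *m x) = 0 -> x = 0.
  by move=> x0; apply/eqP; apply: contraT => /hW; rewrite x0 ltxx.
have [l hl|X [sX eX hX]] := @riccati_stabilizing _ _ (AK A B K) _ W sbS sW S0.
  apply/eqP => l0.
  have [w [x1 [x2 [y1 [y2 [[e1 e2 e3 e4]]]]]]] := hamilton_imag sbS sW hl l0; apply.
  pose v := cmx (Bw^T *m x1) (Bw^T *m x2); pose y := cmx y1 y2.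
  have ev : cnorm2 v = dot x1 (W *m x1) + dot x2 (W *m x2).
    by rewrite cnorm2E rmx_cmx imx_cmx !dot_W.
  have eT : Tinf A B Bw Qinf Rinf K (- w) *m v =
     mxC (col_mx (sqrtm Qinf) (sqrtm Rinf *m K)) *m y.
    rewrite /Tinf -!mulmxA; congr (_ *m _).
    have -> : mxC Bw *m v = ((Complex 0 (- w))%:M - mxC (AK A B K)) *m y.
      apply: mxC_inj.
        rewrite rmx_mull rmx_resolvent !rmx_cmx imx_cmx mulmxA scaleNr opprK.
        by rewrite -e3 addrK.
      rewrite imx_mull imx_resolvent !imx_cmx rmx_cmx mulmxA scaleNr -e4.
      by rewrite addrK.
    by rewrite mulKmx // hurwitz_unit.
  (* Pairing the four equations with [y1], [y2], [x1], [x2] and cancelling the terms in [AK] and [w]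
     equates the output energy with [beta^2] times the input energy. *)
  have eyx : dot y1 (S *m y1) + dot y2 (S *m y2) = beta ^+ 2 * cnorm2 v.
    have f1 := congr1 (dot y1) e1; have f2 := congr1 (dot y2) e2.
    have f3 := congr1 (dot x1) e3; have f4 := congr1 (dot x2) e4.
    move: f1 f2 f3 f4; rewrite -!scalemxAl !dotL -!dotMl.
    rewrite (dotC (_ *m y1) x1) (dotC (_ *m y2) x2) (dotC y1 x2) (dotC y2 x1) ev.
    move=> f1 f2 f3 f4; rewrite -[LHS](mulVKf (lt0r_neq0 b2)); congr (_ * _).
    by rewrite mulrDr; exact: (aux _ _ _ _ _ _ _ _ f1 f2 f3 f4).
  (* A zero input forces [x1 = x2 = 0] because [W > 0], then [y1 = y2 = 0] because [S > 0], so the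
     eigenvector would vanish. *)
  have [v0|v0] := eqVneq v 0.
    move: ev; rewrite v0 cnorm2E.
    have -> : rmx (0 : 'cV[R[i]]_n) = 0 by apply/matrixP => i j; rewrite !mxE.
    have -> : imx (0 : 'cV[R[i]]_n) = 0 by apply/matrixP => i j; rewrite !mxE.
    rewrite !dot0r addr0 => /esym/eqP.
    rewrite paddr_eq0 ?dot_W ?dot_ge0 // -!dot_W => /andP[/eqP/W0 x10 /eqP/W0 x20].
    move: e1 e2; rewrite x10 x20 !mulmx0 !add0r scaler0 oppr0 => e1 e2.
    by split=> //; apply: S0; rewrite ?e1 ?e2 dot0r.
  have : (beta%:E <= hinf_norm A B Bw Qinf Rinf K)%E.
    apply: ereal_sup_ubound; exists (- w), v; split=> //.
    rewrite eT cnorm2E rmx_mull imx_mull rmx_cmx imx_cmx -!dot_SK -/S eyx.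
    by rewrite mulfK ?gt_eqF ?cnorm2_gt0 // sqrtr_sqr gtr0_norm.
  by rewrite leNgt hinf.
exists X; split; first exact: sX.
split; last by rewrite scalemxAr.
by move: eX; rewrite -scalemxAr -scalemxAl.
Qed.

(** [X] is a Lyapunov matrix for the transposed closed loop, strict because [W > 0]. Evaluated at
    [X^-1 x], with [x] the state response, the inequality bounds the gain by [b]; the margin
    [b < beta] keeps the supremum over frequencies strictly below [beta]. *)
Lemma riccati_ineq_Kbeta K X b : 0 < b < beta -> pd X ->
  (forall x, 2 * dot ((AK A B K)^T *m x) (X *m x)
     + b ^- 2 * dot (X *m x) (SK Qinf Rinf K *m (X *m x)) + dot x (Wmat Bw *m x) <= 0) ->
  Kbeta A B Bw Qinf Rinf beta K.
Proof.
move=> /andP[bp bb] pX hX; have uX := pd_unit pX; have /pdP[sX X0] := pX.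
have /pdP[sS hS] := SK_pd K; have /pdP[sW hW] := pW.
have S0 x : 0 <= dot x (SK Qinf Rinf K *m x) by case/psdP: (pd_psd (SK_pd K)).
have W0 x : 0 <= dot x (Wmat Bw *m x) by case/psdP: (pd_psd pW).
have b2 : 0 < b ^- 2 by rewrite invr_gt0 exprn_gt0.
have hK : hurwitz (AK A B K).
  move=> l /eigenvalueP[u ul u0].
  have er : (AK A B K)^T *m (rmx u)^T = complex.Re l *: (rmx u)^T - complex.Im l *: (imx u)^T.
    by rewrite -trmx_mul -rmx_mulr ul rmxZ linearB !linearZ.
  have ei : (AK A B K)^T *m (imx u)^T = complex.Im l *: (rmx u)^T + complex.Re l *: (imx u)^T.
    by rewrite -trmx_mul -imx_mulr ul imxZ linearD !linearZ.
  have := hX (rmx u)^T; have := hX (imx u)^T.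
  rewrite er ei !dotL.
  have := S0 (X *m (rmx u)^T); have := S0 (X *m (imx u)^T).
  have : (rmx u)^T != 0 \/ (imx u)^T != 0.
    rewrite !trmx_eq0; have [r0|] := eqVneq (rmx u) 0; last by left.
    right; apply: contraNneq u0 => i0; apply/eqP; exact: mxC_eq0.
  have -> : dot (imx u)^T (X *m (rmx u)^T) = dot (rmx u)^T (X *m (imx u)^T).
    by rewrite dotMr sX dotC.
  move: (rmx u)^T (imx u)^T => a c ac.
  have Xa : 0 <= dot a (X *m a) by case/psdP: (pd_psd pX).
  have Xc : 0 <= dot c (X *m c) by case/psdP: (pd_psd pX).
  have Wac : 0 < dot a (Wmat Bw *m a) + dot c (Wmat Bw *m c).
    by case: ac => /hW h; [apply: ltr_wpDr | apply: ltr_wpDl].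
  set s1 := dot (X *m c) _; set s2 := dot (X *m a) _ => s10 s20 h1 h2.
  have : 0 <= b ^- 2 * s1 by rewrite mulr_ge0 // ltW.
  have : 0 <= b ^- 2 * s2 by rewrite mulr_ge0 // ltW.
  rewrite ltNge => h3 h4; apply/negP => h5.
  have : 0 <= complex.Re l * (dot a (X *m a) + dot c (X *m c)) by rewrite mulr_ge0 // addr_ge0.
  lra.
split=> //; apply: le_lt_trans (_ : (b%:E < beta%:E)%E); last by rewrite lte_fin.
apply: ge_ereal_sup => _ [w [v [v0 ->]]]; rewrite lee_fin.
have v2 := cnorm2_gt0 v0.
rewrite -[leRHS](gtr0_norm bp) -sqrtr_sqr ler_wsqrtr // ler_pdivrMr //.
pose x := invmx ((Complex 0 w)%:M - mxC (AK A B K)) *m (mxC Bw *m v).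
have ex : ((Complex 0 w)%:M - mxC (AK A B K)) *m x = mxC Bw *m v.
  by rewrite mulKVmx // hurwitz_unit.
rewrite /Tinf -!mulmxA -/x !cnorm2E rmx_mull imx_mull -!dot_SK.
have := congr1 (@imx _ _ _) ex; have := congr1 (@rmx _ _ _) ex.
rewrite rmx_resolvent imx_resolvent rmx_mull imx_mull.
move: (rmx x) (imx x) (rmx v) (imx v) => x1 x2 v1 v2' e1 e2 {ex x v2 v0}.
have := hX (invmx X *m x1); have := hX (invmx X *m x2).
have f1 := congr1 (dot (invmx X *m x1)) e1.
have f2 := congr1 (dot (invmx X *m x2)) e2.
move: f1 f2; rewrite !mulKVmx // !dotL !dot_W.
rewrite (dotMl (invmx X) x1 x2) (sym_inv sX) (dotC x1).
(* These squares give [2 <Bw^T X^-1 x, v> <= |Bw^T X^-1 x|^2 + |v|^2] for the real and the imaginary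
   parts. *)
have := dot_ge0 (Bw^T *m (invmx X *m x1) - v1).
have := dot_ge0 (Bw^T *m (invmx X *m x2) - v2').
rewrite !dotL (dotC v1) (dotC v2').
have -> : dot (invmx X *m x1) (Bw *m v1) = dot (Bw^T *m (invmx X *m x1)) v1 by rewrite dotMr.
have -> : dot (invmx X *m x2) (Bw *m v2') = dot (Bw^T *m (invmx X *m x2)) v2' by rewrite dotMr.
rewrite !(dotMl (AK A B K)^T) !trmxK.
set t1 := dot (Bw^T *m (invmx X *m x1)) _; set t2 := dot (Bw^T *m (invmx X *m x2)) _.
set s1 := dot x1 _; set s2 := dot x2 _ => h1 h2 h3 h4 h5 h6.
rewrite -ler_pdivrMl ?exprn_gt0 //; lra.
Qed.

End BoundedReal.

(** * Minimization over a compact set of matrices *)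

Section Trace.
Variable R : realType.

Lemma psd_diag_ge0 k (P : 'M[R]_k) i : psd P -> 0 <= P i i.
Proof. by case/psdP => _ h; rewrite mx_entry_dot. Qed.

Lemma psd_tr_ge0 k (P : 'M[R]_k) : psd P -> 0 <= \tr P.
Proof. by move=> hP; apply: sumr_ge0 => i _; apply: psd_diag_ge0. Qed.

Lemma psd_diag_le_tr k (P : 'M[R]_k) i : psd P -> P i i <= \tr P.
Proof.
move=> hP; rewrite /mxtrace (bigD1 i) //= lerDl.
by apply: sumr_ge0 => j _; apply: psd_diag_ge0.
Qed.

(** The quadratic form at [e_i + e_j] and at [e_i - e_j] gives [2 |P_ij| <= P_ii + P_jj]. *)
Lemma psd_entry_le k (P : 'M[R]_k) i j : psd P -> `|P i j| <= \tr P.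
Proof.
move=> hP; have := psd_diag_le_tr i hP; have := psd_diag_le_tr j hP.
case/psdP: hP => sP hP.
have sij : P j i = P i j by rewrite -{1}sP mxE.
have := hP (delta_mx i 0 + delta_mx j 0); have := hP (delta_mx i 0 - delta_mx j 0).
rewrite !mulmxDr !mulmxN !dotL -!mx_entry_dot sij ler_norml; lra.
Qed.

(** If [D = T T] with [T] symmetric, the trace is that of [T N T]. To have such a root, [D] is first
    perturbed to the positive definite [D + e 1]. *)
Lemma psd_tr_mul k (N D : 'M[R]_k) : psd N -> psd D -> 0 <= \tr (N *m D).
Proof.
move=> hN hD.
have pos e : 0 < e -> 0 <= \tr (N *m D) + e * \tr N.
  move=> e0; have pD : pd (D + e *: 1%:M).
    by apply: psdD_pd => //; apply: pdZ => //; exact: pd1.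
  have [/psdP[sT _] TT] := sqrtm_pd pD.
  have -> : \tr (N *m D) + e * \tr N = \tr (N *m (D + e *: 1%:M)).
    by rewrite mulmxDr -scalemxAr mulmx1 mxtraceD mxtraceZ.
  rewrite -TT mulmxA mxtrace_mulC mulmxA; apply: psd_tr_ge0.
  by rewrite -{1}sT; apply: psd_congr.
have N0 := psd_tr_ge0 hN; rewrite leNgt; apply/negP => h.
have N1 : 0 < \tr N + 1 by apply: ltr_wpDl.
(* This [e] leaves the perturbed trace equal to [tr (N D) / (tr N + 1)], still negative. *)
have := pos (- \tr (N *m D) / (\tr N + 1)).
rewrite divr_gt0 ?oppr_gt0 // => /(_ isT).
have -> : \tr (N *m D) + - \tr (N *m D) / (\tr N + 1) * \tr N =
  \tr (N *m D) / (\tr N + 1) by field; rewrite gt_eqF.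
by rewrite leNgt => /negP; apply; rewrite pmulr_llt0 ?invr_gt0.
Qed.

End Trace.

(** * Continuity of matrix-valued maps and the extreme value theorem *)

Section Attainment.
Variable R : realType.

(** Entrywise, so that products and traces reduce to finite sums of real functions. *)
Definition mcont (T : topologicalType) p q (F : T -> 'M[R]_(p, q)) :=
  forall i j, continuous (fun v => F v i j).

Lemma cont_sum (T : topologicalType) (I : finType) (F : I -> T -> R) :
  (forall i, continuous (F i)) -> continuous (fun v => \sum_i F i v).
Proof.
by move=> cF; apply: continuous_big => [|i _]; [exact: add_continuous | exact: cF].
Qed.

Lemma mcont_cst (T : topologicalType) p q (M : 'M[R]_(p, q)) : mcont (fun _ : T => M).
Proof. by move=> i j v; apply: cst_continuous. Qed.

Lemma mcontM (T : topologicalType) p q r (F : T -> 'M[R]_(p, q)) (G : T -> 'M[R]_(q, r)) :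
  mcont F -> mcont G -> mcont (fun v => F v *m G v).
Proof.
move=> cF cG i j v.
have -> : (fun v => (F v *m G v) i j) = (fun v => \sum_k F v i k * G v k j).
  by apply/funext => u; rewrite mxE.
apply: cont_sum => k u; exact: cvgM (cF i k u) (cG k j u).
Qed.

Lemma mcontT (T : topologicalType) p q (F : T -> 'M[R]_(p, q)) :
  mcont F -> mcont (fun v => (F v)^T).
Proof.
move=> cF i j; have -> : (fun v => (F v)^T i j) = (fun v => F v j i).
  by apply/funext => u; rewrite mxE.
exact: cF.
Qed.

Lemma cont_dot (T : topologicalType) p (F G : T -> 'cV[R]_p) :
  mcont F -> mcont G -> continuous (fun v => dot (F v) (G v)).
Proof. by move=> cF cG; apply: (mcontM (mcontT cF) cG). Qed.

Lemma cont_tr (T : topologicalType) p (F : T -> 'M[R]_p) :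
  mcont F -> continuous (fun v => \tr (F v)).
Proof. by move=> cF; apply: cont_sum => k; apply: cF. Qed.

(** The constraint set is an intersection of closed preimages of a half line and is bounded;
    flattening matrices to row vectors makes it compact. *)
Lemma compact_min_mx k (I : Type) (g : I -> 'M[R]_k -> R) (f : 'M[R]_k -> R) C :
  (forall i, continuous (fun v : 'rV[R]_(k * k) => g i (vec_mx v))) ->
  continuous (fun v : 'rV[R]_(k * k) => f (vec_mx v)) ->
  (forall M, (forall i, 0 <= g i M) -> forall a b, `|M a b| <= C) ->
  (exists M, forall i, 0 <= g i M) ->
  exists2 M, (forall i, 0 <= g i M) &
    forall M', (forall i, 0 <= g i M') -> f M <= f M'.
Proof.
move=> cg cf bd [M0 hM0].
pose E := [set v : 'rV[R]_(k * k) | forall i, 0 <= g i (vec_mx v)]%classic.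
have clE : closed E.
  have -> : E = (\bigcap_i ((fun v : 'rV[R]_(k * k) => g i (vec_mx v)) @^-1`
                     [set x | 0 <= x]))%classic.
    by apply/seteqP; split => v h i; [move=> _; exact: (h i) | exact: (h i Logic.I)].
  apply: closed_bigI => i _; apply: preimage_closed; last exact: closed_ge.
  by move=> v _; apply: cg.
(* For [k = 0] the entry bound is vacuous and [C] may be negative, while the norm is a maximum
   starting from zero. *)
have C0 : 0 <= Num.max 0 C by rewrite le_max lexx.
have bdE : bounded_set E.
  exists (Num.max 0 C); split; first exact: num_real.
  move=> x Cx v /= Ev; apply: le_trans (ltW Cx).
  rewrite [leLHS]/Num.Def.normr /= mx_normrE; apply/bigmax_leP; split=> //= -[i j] _ /=.
  rewrite (ord1 i) le_max; case/mxvec_indexP: j => a b.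
  by rewrite -[v]vec_mxK mxvecE bd ?orbT.
have nE : (E !=set0)%classic by exists (mxvec M0) => i /=; rewrite mxvecK.
have [|c] := EVT_min_rV nE (bounded_closed_compact bdE clE) (f := fun v => f (vec_mx v)).
  exact: continuous_subspaceT.
rewrite inE => Ec hc; exists (vec_mx c) => // M' hM'.
by have := hc (mxvec M'); rewrite inE mxvecK; apply; move=> i /=; rewrite mxvecK.
Qed.

End Attainment.

(* [continuous] unfolds to a product, whose bound variables would be made implicit. *)
Arguments cont_dot {R T p F G} _ _ _.
Arguments cont_tr {R T p F} _ _.
Arguments mcont_cst {R T p q} M _ _ _.
Arguments mcontM {R T p q r F G} _ _ _ _ _.

(** * The convex program *)

Section ConvexProblem.
Variable R : realType.
Variables (n m : nat) (A : 'M[R]_n) (B : 'M[R]_(n, m)) (Bw : 'M[R]_n)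
  (Q2 Qinf : 'M[R]_n) (R2 Rinf : 'M[R]_m) (beta : R).
Hypotheses (b0 : 0 < beta) (pQ2 : psd Q2) (pW : pd (Wmat Bw)) (pQ : pd Qinf)
  (pR2 : pd R2) (pR : pd Rinf).

(** For symmetric [X], the quadratic form of [A X + X A^T + B Y + Y^T B^T + s (X Qinf X + Y^T Rinf
    Y) + W], which for [s = beta^-2] is a Schur complement of [Fcvx_mx]. A free [s] allows comparing
    different levels. *)
Definition riccati_form (s : R) (X : 'M[R]_n) (Y : 'M[R]_(m, n)) (x : 'cV[R]_n) : R :=
  2 * dot (A^T *m x) (X *m x) + 2 * dot (B^T *m x) (Y *m x)
  + s * (dot (X *m x) (Qinf *m (X *m x)) + dot (Y *m x) (Rinf *m (Y *m x)))
  + dot x (Wmat Bw *m x).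

Lemma riccati_form_gain s K X x : riccati_form s X (K *m X) x =
  2 * dot ((AK A B K)^T *m x) (X *m x)
     + s * dot (X *m x) (SK Qinf Rinf K *m (X *m x)) + dot x (Wmat Bw *m x).
Proof.
rewrite /riccati_form /AK /SK linearD /= trmx_mul !mulmxDl -!mulmxA !dotL.
rewrite (dotMl K^T) trmxK (dotMr K^T) trmxK; ring.
Qed.

Lemma Fcvx_mx_quad (X : 'M[R]_n) (Y : 'M[R]_(m, n)) x a c : X^T = X ->
  let z := col_mx x (col_mx a c) in
  dot z (Fcvx_mx A B Bw Qinf Rinf beta X Y *m z) =
  2 * dot (A^T *m x) (X *m x) + 2 * dot (B^T *m x) (Y *m x) + dot x (Wmat Bw *m x)
  + 2 * dot a (sqrtm Qinf *m (X *m x)) + 2 * dot c (sqrtm Rinf *m (Y *m x))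
  - beta ^+ 2 * (dot a a + dot c c).
Proof.
move=> sX /=; have [[/psdP[sq _] _] [/psdP[sr _] _]] := (sqrtm_pd pQ, sqrtm_pd pR).
rewrite /Fcvx_mx !mul_block_col mul_row_col mul_col_mx add_col_mx !dot_col_mx.
rewrite !mul0mx add0r addr0 -!scalemxAl !mul1mx !mulmxDl !dotL -!mulmxA.
rewrite (dotMr A x) (dotMr X x) sX (dotC (X *m x)) (dotMr B x) (dotMr Y^T x) trmxK.
rewrite (dotC (Y *m x) (B^T *m x)).
rewrite (dotMr X x) sX (dotMr (sqrtm Qinf) (X *m x)) sq (dotC _ a).
rewrite (dotMr Y^T x) trmxK (dotMr (sqrtm Rinf) (Y *m x)) sr (dotC _ c).
ring.
Qed.

Lemma Fcvx_mx_sym (X : 'M[R]_n) (Y : 'M[R]_(m, n)) : X^T = X ->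
  (Fcvx_mx A B Bw Qinf Rinf beta X Y)^T = Fcvx_mx A B Bw Qinf Rinf beta X Y.
Proof.
move=> sX; have [[/psdP[sq _] _] [/psdP[sr _] _]] := (sqrtm_pd pQ, sqrtm_pd pR).
have /pdP[sW _] := pW.
rewrite /Fcvx_mx !tr_block_mx tr_row_mx tr_col_mx !trmx_mul !trmx0 trmxK sX sq sr.
rewrite !linearZ /= !trmx1; congr block_mx.
rewrite !linearD /= sW !trmx_mul !trmxK sX.
by rewrite (addrC (X *m A^T)) -!addrA; congr (_ + (_ + _)); rewrite addrCA.
Qed.

(** The form of [Fcvx_mx] is maximized over its lower blocks [a] and [c]: forward the maximizer is
    inserted, backward each block is bounded by completing a square. *)
Lemma nsd_Fcvx_mxP (X : 'M[R]_n) (Y : 'M[R]_(m, n)) : X^T = X ->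
  nsd (Fcvx_mx A B Bw Qinf Rinf beta X Y) <-> forall x, riccati_form (beta ^- 2) X Y x <= 0.
Proof.
move=> sX; have [[/psdP[sq _] eq] [/psdP[sr _] er]] := (sqrtm_pd pQ, sqrtm_pd pR).
have b2 : 0 < beta ^+ 2 by rewrite exprn_gt0.
have nq x : dot x (Qinf *m x) = dot (sqrtm Qinf *m x) (sqrtm Qinf *m x).
  by rewrite dotMl sq mulmxA eq.
have nr x : dot x (Rinf *m x) = dot (sqrtm Rinf *m x) (sqrtm Rinf *m x).
  by rewrite dotMl sr mulmxA er.
split=> [/psdP[_ hF] x|h].
  have := hF (col_mx x (col_mx (beta ^- 2 *: (sqrtm Qinf *m (X *m x)))
                               (beta ^- 2 *: (sqrtm Rinf *m (Y *m x))))).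
  rewrite mulNmx dotNr Fcvx_mx_quad // !dotL oppr_ge0 /riccati_form nq nr.
  set p := dot (sqrtm Qinf *m _) _; set q := dot (sqrtm Rinf *m _) _.
  set u := dot (A^T *m x) _; set v := dot (B^T *m x) _; set w := dot x _.
  suff -> : 2 * u + 2 * v + beta ^- 2 * (p + q) + w = 2 * u + 2 * v + w +
    2 * (beta ^- 2 * p) + 2 * (beta ^- 2 * q) - beta ^+ 2 *
    (beta ^- 2 * (beta ^- 2 * p) + beta ^- 2 * (beta ^- 2 * q)) by [].
  clearbody p q u v w; field; by rewrite -sqrf_eq0 gt_eqF.
apply/psdP; split; first by rewrite linearN /= Fcvx_mx_sym.
move=> z; rewrite -(vsubmxK z) -(vsubmxK (dsubmx z)).
move: (usubmx z) (usubmx (dsubmx z)) (dsubmx (dsubmx z)) => x a c.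
rewrite mulNmx dotNr Fcvx_mx_quad // oppr_ge0; have := h x; rewrite /riccati_form nq nr.
have amgm k (p e : 'cV[R]_k) : 2 * dot e p - beta ^+ 2 * dot e e <= beta ^- 2 * dot p p.
  have := dot_ge0 (beta ^+ 2 *: e - p); rewrite !dotL (dotC p e) => hd.
  rewrite ler_pdivlMl //; lra.
have := amgm _ (sqrtm Qinf *m (X *m x)) a; have := amgm _ (sqrtm Rinf *m (Y *m x)) c.
lra.
Qed.

(** Only the terms in [Qinf] and [Rinf] are not affine in [(X, Y)]; their convexity gap is
    [t (1 - t) <y - z, P (y - z)>]. *)
Lemma riccati_form_convex s X1 Y1 X2 Y2 t x : 0 <= s -> 0 <= t <= 1 ->
  riccati_form s ((1 - t) *: X1 + t *: X2) ((1 - t) *: Y1 + t *: Y2) x <=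
  (1 - t) * riccati_form s X1 Y1 x + t * riccati_form s X2 Y2 x.
Proof.
move=> s0 /andP[t0 t1]; rewrite /riccati_form !mulmxDl -!scalemxAl.
have conv k (P : 'M[R]_k) y z : psd P ->
    dot ((1 - t) *: y + t *: z) (P *m ((1 - t) *: y + t *: z)) <=
    (1 - t) * dot y (P *m y) + t * dot z (P *m z).
  case/psdP=> sP /(_ (y - z)); rewrite !mulmxDr !mulmxN -!scalemxAr !dotL.
  have -> : dot z (P *m y) = dot y (P *m z) by rewrite dotMr sP dotC.
  set c := dot y (P *m z); set a := dot y _; set b := dot z _ => h.
  have := mulr_ge0 (mulr_ge0 t0 (_ : 0 <= 1 - t)) h; rewrite subr_ge0 t1 => /(_ isT).
  clearbody a b c; nra.
have := conv _ Qinf (X1 *m x) (X2 *m x) (pd_psd pQ).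
have := conv _ Rinf (Y1 *m x) (Y2 *m x) (pd_psd pR).
rewrite !dotDr !dotZr.
set f := dot _ (Rinf *m (_ + _)); set g := dot _ (Qinf *m (_ + _)).
set f1 := dot (Y1 *m x) _; set f2 := dot (Y2 *m x) _.
set g1 := dot (X1 *m x) _; set g2 := dot (X2 *m x) _.
move=> hf hg; have := ler_wpM2l s0 (lerD hf hg).
set sfg := s * (f + g) => h.
have -> : s * (g + f) = sfg by rewrite addrC.
clearbody sfg f1 f2 g1 g2.
set a1 := dot _ (X1 *m x); set a2 := dot _ (X2 *m x).
set a3 := dot _ (Y1 *m x); set a4 := dot _ (Y2 *m x); set w := dot x _.
clearbody a1 a2 a3 a4 w; lra.
Qed.

(** * Relaxation of the convex program by a slack block *)

Definition blkZ (M : 'M[R]_(m + n)) : 'M[R]_m := ulsubmx M.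
Definition blkY (M : 'M[R]_(m + n)) : 'M[R]_(m, n) := ursubmx M.
Definition blkX (M : 'M[R]_(m + n)) : 'M[R]_n := drsubmx M.

(* The slack block [Z] of [M = [Z Y; Y^T X]] stands for [Y X^-1 Y^T]. *)
Definition feasible (M : 'M[R]_(m + n)) : Prop :=
  psd M /\ forall x, riccati_form (beta ^- 2) (blkX M) (blkY M) x <= 0.

Definition lmi_cost (M : 'M[R]_(m + n)) : R := \tr (Q2 *m blkX M) + \tr (R2 *m blkZ M).

Definition lmi_lift (X : 'M[R]_n) (Y : 'M[R]_(m, n)) : 'M[R]_(m + n) :=
  block_mx (Y *m invmx X *m Y^T) Y Y^T X.

Lemma blk_quad M a b : M^T = M -> dot (col_mx a b) (M *m col_mx a b) =
  dot a (blkZ M *m a) + 2 * dot a (blkY M *m b) + dot b (blkX M *m b).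
Proof.
move=> sM; have sY : dlsubmx M = (blkY M)^T by rewrite /blkY trmx_ursub sM.
rewrite -{1}(submxK M) mul_block_col dot_col_mx sY !dotDr.
rewrite (dotMr (blkY M)^T) trmxK (dotC _ a) -/(blkZ M) -/(blkX M) -/(blkY M); ring.
Qed.

Lemma blkX_psd M : psd M -> psd (blkX M).
Proof.
case/psdP=> sM hM; apply/psdP; split; first by rewrite /blkX trmx_drsub sM.
by move=> x; have := hM (col_mx 0 x); rewrite blk_quad // !dot0l mulr0 !add0r.
Qed.

Lemma blkZ_psd M : psd M -> psd (blkZ M).
Proof.
case/psdP=> sM hM; apply/psdP; split; first by rewrite /blkZ trmx_ulsub sM.
by move=> x; have := hM (col_mx x 0); rewrite blk_quad // !mulmx0 !dot0r mulr0 !addr0.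
Qed.

(** If [<x, X x> = 0], then [M] kills [(0, x)], so [X x = 0] and [Y x = 0]; the Riccati form reduces
    to [<x, W x>], which is positive for nonzero [x]. *)
Lemma feasible_pd M : feasible M -> pd (blkX M).
Proof.
move=> [pM hM]; have /psdP[sX hX] := blkX_psd pM; apply/pdP; split=> // x x0.
rewrite lt_def hX andbT; apply/eqP => q0.
have /psdP[sM _] := pM.
have : M *m col_mx 0 x = 0.
  by apply: psd_quad_eq0 => //; rewrite blk_quad // !dot0l mulr0 !add0r.
rewrite -{1}(submxK M) mul_block_col !mulmx0 !add0r -col_mx0.
move=> /eq_col_mx[Yx Xx].
have := hM x; rewrite /riccati_form /blkX /blkY Yx Xx !mulmx0 !dot0r !addr0 !mulr0 !add0r.
by rewrite leNgt; case/pdP: pW => _ ->.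
Qed.

(** The form of [M] at [(a, - X^-1 Y^T a)] shows that [Z - Y X^-1 Y^T] is positive semidefinite, and
    [psd_tr_mul] weighs it by [R2]. *)
Lemma lmi_cost_lb M : psd M -> pd (blkX M) ->
  \tr (Q2 *m blkX M) + \tr (R2 *m blkY M *m invmx (blkX M) *m (blkY M)^T) <= lmi_cost M.
Proof.
move=> /psdP[sM hM] pX; rewrite /lmi_cost lerD2l -subr_ge0.
have uX := pd_unit pX; case/pdP: pX => sX _.
rewrite -!mulmxA -linearB -mulmxBr; apply: psd_tr_mul; first exact: pd_psd.
apply/psdP; split.
  by rewrite linearB /= !trmx_mul trmxK sym_inv // !mulmxA /blkZ trmx_ulsub sM.
move=> a; have := hM (col_mx a (- (invmx (blkX M) *m ((blkY M)^T *m a)))).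
rewrite blk_quad // !mulmxN mulKVmx // !dotL mulmxBl dotDr dotNr -!mulmxA.
by rewrite (dotC _ ((blkY M)^T *m a)) (dotMl (blkY M)^T) trmxK => h; lra.
Qed.

Lemma lmi_lift_psd X Y : pd X -> psd (lmi_lift X Y).
Proof.
move=> pX; have uX := pd_unit pX; have /pdP[sX _] := pX.
have -> : lmi_lift X Y = (row_mx (invmx X *m Y^T) 1%:M)^T *m X *m row_mx (invmx X *m Y^T) 1%:M.
  rewrite tr_row_mx trmx_mul trmxK sym_inv // trmx1 mul_col_mx mul_col_row.
  by rewrite !mul1mx !mulmx1 mulKVmx // mulmxKV // !mulmxA.
exact/psd_congr/pd_psd.
Qed.

Lemma feasible_lift X Y : pd X -> (forall x, riccati_form (beta ^- 2) X Y x <= 0) -> feasible (lmi_lift X Y).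
Proof.
by move=> pX h; split; [exact: lmi_lift_psd | rewrite /blkX /blkY block_mxKur block_mxKdr].
Qed.

Lemma lmi_cost_lift X Y : lmi_cost (lmi_lift X Y) = \tr (Q2 *m X) + \tr (R2 *m Y *m invmx X *m Y^T).
Proof. by rewrite /lmi_cost /blkX /blkZ block_mxKul block_mxKdr -!mulmxA. Qed.

Lemma lmi_cost_gain K X : pd X ->
  \tr (Q2 *m X) + \tr (R2 *m (K *m X) *m invmx X *m (K *m X)^T) =
  \tr ((Q2 + K^T *m R2 *m K) *m X).
Proof.
move=> pX; have uX := pd_unit pX; case/pdP: pX => sX _.
rewrite trmx_mul sX mulmxDl mxtraceD; congr (_ + _).
rewrite -(mulmxA R2) mulmxK // mulmxA [LHS]mxtrace_mulC.
by rewrite !mulmxA.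
Qed.

Lemma Fcvx_feasible g X Y : Fcvx A B Bw Q2 Qinf R2 Rinf beta g X Y ->
  feasible (lmi_lift X Y) /\ lmi_cost (lmi_lift X Y) <= g.
Proof.
move=> [pX [/nsd_Fcvx_mxP hF hg]]; split; last by rewrite lmi_cost_lift.
by apply: feasible_lift => //; apply: hF; case: pX.
Qed.

Lemma feasible_Fcvx M : feasible M ->
  Fcvx A B Bw Q2 Qinf R2 Rinf beta (lmi_cost M) (blkX M) (blkY M).
Proof.
move=> fM; have pX := feasible_pd fM; case: fM => pM hM.
split=> //; split; last exact: lmi_cost_lb.
by apply/nsd_Fcvx_mxP => //; case: pX.
Qed.

(** The cost bounds the trace of [Z] since [R2 >= e2]. In the Riccati form at a basis vector the
    quadratic terms dominate the linear ones, which bounds the diagonal of [X]. The trace then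
    bounds every entry. *)
Lemma feasible_bounded c : exists C, forall M, feasible M -> lmi_cost M <= c ->
  forall i j, `|M i j| <= C.
Proof.
have [e2 e20 h2] := pd_lbound pR2.
have [q q0 hq] := pd_lbound pQ; have [r r0 hr] := pd_lbound pR.
set s := beta ^- 2; have s0 : 0 < s by rewrite invr_gt0 exprn_gt0.
pose u i : 'cV[R]_n := A^T *m delta_mx i 0; pose v i : 'cV[R]_m := B^T *m delta_mx i 0.
pose D i := 1 + (2 * dot (u i) (u i) / (s * q) + dot (v i) (v i) / (s * r)) / (s * q / 2).
exists (c / e2 + \sum_i D i) => M [pM hM] hc i j.
apply: le_trans (psd_entry_le i j pM) _.
have -> : \tr M = \tr (blkZ M) + \tr (blkX M) by rewrite -{1}(submxK M) mxtrace_block.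
have pX := blkX_psd pM; have pZ := blkZ_psd pM.
apply: lerD.
  rewrite ler_pdivlMr // mulrC -mxtraceZ.
  apply: le_trans hc; rewrite /lmi_cost.
  have := psd_tr_mul pQ2 pX.
  have : 0 <= \tr ((R2 - e2 *: 1%:M) *m blkZ M).
    apply: psd_tr_mul => //; apply/psdP; case/pdP: pR2 => sR _; split.
      by rewrite linearB linearZ /= trmx1 sR.
    by move=> x; rewrite mulmxBl dotDr dotNr -scalemxAl mul1mx dotZr subr_ge0.
  by rewrite mulmxBl linearB /= -scalemxAl mul1mx; lra.
apply: ler_sum => k _.
have := hM (delta_mx k 0); rewrite /riccati_form -/(u k) -/(v k) -/s.
set p := blkX M *m _; set y := blkY M *m _.
have hp : blkX M k k <= 1 + dot p p.
  have -> : blkX M k k = dot (delta_mx k 0) p by rewrite mx_entry_dot.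
  have := dot_ge0 (delta_mx k 0 - p); rewrite !dotL (dotC p).
  have -> : dot (delta_mx k 0) (delta_mx k 0) = 1 :> R.
    by rewrite /dot trmx_delta mul_delta_mx mxE !eqxx.
  have := dot_ge0 p; lra.
have w0 : 0 <= dot (delta_mx k 0) (Wmat Bw *m delta_mx k 0).
  by case/psdP: (pd_psd pW).
have := hq p; have := hr y.
have sq0 : 0 < s * q by rewrite mulr_gt0.
have sr0 : 0 < s * r by rewrite mulr_gt0.
have := dot_ge0 (2 *: u k + (s * q) *: p); have := dot_ge0 (v k + (s * r) *: y).
rewrite !dotL (dotC p (u k)) (dotC y (v k)).
set aa := dot (u k) (u k); set ab := dot (u k) p; set bb := dot p p.
set cc := dot (v k) (v k); set cd := dot (v k) y; set dd := dot y y.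
set qq := dot p (Qinf *m p); set rr := dot y (Rinf *m y).
move=> h2' h1' hrr hqq hric; apply: le_trans hp _; rewrite /D lerD2l.
rewrite ler_pdivlMr ?divr_gt0 // -/aa -/cc -/bb.
(* Young's inequality spends half of [s q |p|^2] here and all of [s r |y|^2] in [e4]; the other half
   of [s q |p|^2] bounds [|p|^2] as in [D]. *)
have e1 : - (2 * ab) <= 2 * aa / (s * q) + s * q * bb / 2.
  have -> : 2 * aa / (s * q) + s * q * bb / 2 =
     (4 * aa + (s * q) ^+ 2 * bb) / (2 * (s * q)) by field; rewrite gt_eqF //= gt_eqF.
  rewrite ler_pdivlMr ?mulr_gt0 //; lra.
have e4 : - (2 * cd) <= cc / (s * r) + s * r * dd.
  have -> : cc / (s * r) + s * r * dd = (cc + (s * r) ^+ 2 * dd) / (s * r).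
    by field; rewrite gt_eqF //= gt_eqF.
  rewrite ler_pdivlMr //; lra.
have e3 := ler_wpM2l (ltW s0) (lerD hqq hrr).
set xx := 2 * aa / (s * q) in e1 *; set yy := cc / (s * r) in e4 *.
lra.
Qed.

End ConvexProblem.

(** * Gains and the convex program *)

Section Main.
Variable R : realType.
Variables (n m : nat) (A : 'M[R]_n) (B : 'M[R]_(n, m)) (Bw : 'M[R]_n)
  (Q2 Qinf : 'M[R]_n) (R2 Rinf : 'M[R]_m).
Hypotheses (pQ2 : psd Q2) (pW : pd (Wmat Bw)) (pQ : pd Qinf)
  (pR2 : pd R2) (pR : pd Rinf).

Local Notation feas := (feasible A B Bw Qinf Rinf).
Local Notation ricq := (riccati_form A B Bw Qinf Rinf).
Local Notation cost := (lmi_cost Q2 R2).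
Local Notation stab_sol := (stab_sol A B Bw Qinf Rinf).

Lemma cont_riccati_form (T : topologicalType) s (X : T -> 'M[R]_n) (Y : T -> 'M[R]_(m, n)) x :
  mcont X -> mcont Y -> continuous (fun v => ricq s (X v) (Y v) x).
Proof.
move=> cX cY v.
have cXx : mcont (fun v => X v *m x) by apply: mcontM => //; exact: mcont_cst.
have cYx : mcont (fun v => Y v *m x) by apply: mcontM => //; exact: mcont_cst.
rewrite /riccati_form; apply: cvgD; last exact: cvg_cst.
apply: cvgD.
  apply: cvgD; (apply: cvgM; first exact: cvg_cst).
    exact: (cont_dot (mcont_cst _) cXx v).
  exact: (cont_dot (mcont_cst _) cYx v).
apply: cvgM; first exact: cvg_cst.
apply: cvgD; first exact: (cont_dot cXx (mcontM (mcont_cst Qinf) cXx) v).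
exact: (cont_dot cYx (mcontM (mcont_cst Rinf) cYx) v).
Qed.

Arguments cont_riccati_form {T s X Y x} _ _ _.

(** The search is restricted to points costing at most [cost M0], a bounded set. *)
Lemma min_cost_attained beta : 0 < beta -> (exists M, feas beta M) ->
  exists2 M, feas beta M & forall M', feas beta M' -> cost M <= cost M'.
Proof.
move=> b0 [M0 hM0].
have [C hC] := feasible_bounded A B b0 pQ2 pW pQ pR2 pR (cost M0).
(* One index per scalar constraint: symmetry (an equality, by using both orders of the indices),
   semidefiniteness, the Riccati inequality and the cost bound. *)
pose I := ('I_(m + n) * 'I_(m + n) + 'cV[R]_(m + n) + 'cV[R]_n + unit)%type.
pose g (i : I) (M : 'M[R]_(m + n)) := match i with
  | inl (inl (inl (i, j))) => M i j - M j i
  | inl (inl (inr z)) => dot z (M *m z)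
  | inl (inr x) => - ricq (beta ^- 2) (blkX M) (blkY M) x
  | inr _ => cost M0 - cost M
  end.
have gP M : (forall i, 0 <= g i M) <-> feas beta M /\ cost M <= cost M0.
  split=> [h|[[/psdP[sM hM] hr] hc]]; last first.
    case=> [[[[i j]|z]|x]|_] /=.
    - by rewrite -{2}sM mxE subrr.
    - exact: hM.
    - by rewrite oppr_ge0.
    - by rewrite subr_ge0.
  split; last by have := h (inr tt); rewrite /= subr_ge0.
  split; last by move=> x; have := h (inl (inr x)); rewrite /= oppr_ge0.
  apply/psdP; split; last by move=> z; exact: (h (inl (inl (inr z)))).
  apply/matrixP => i j; rewrite mxE.
  have := h (inl (inl (inl (i, j)))); have := h (inl (inl (inl (j, i)))).
  by rewrite /= !subr_ge0 => a b; apply/le_anti; rewrite a b.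
have cv : mcont (fun v : 'rV[R]_((m + n) * (m + n)) => vec_mx v : 'M[R]_(m + n)).
  move=> i j; have -> : (fun v : 'rV[R]_((m + n) * (m + n)) => (vec_mx v : 'M[R]_(m + n)) i j) =
      (fun v => v 0 (mxvec_index i j)) by apply/funext => v; rewrite mxE.
  exact: coord_continuous.
have cX : mcont (fun v : 'rV[R]_((m + n) * (m + n)) => blkX (vec_mx v : 'M[R]_(m + n))).
  move=> i j; have -> : (fun v : 'rV[R]_((m + n) * (m + n)) => blkX (vec_mx v : 'M[R]_(m + n)) i j) =
      (fun v => (vec_mx v : 'M[R]_(m + n)) (rshift m i) (rshift m j)).
    by apply/funext => v; rewrite !mxE.
  exact: cv.
have cY : mcont (fun v : 'rV[R]_((m + n) * (m + n)) => blkY (vec_mx v : 'M[R]_(m + n))).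
  move=> i j; have -> : (fun v : 'rV[R]_((m + n) * (m + n)) => blkY (vec_mx v : 'M[R]_(m + n)) i j) =
      (fun v => (vec_mx v : 'M[R]_(m + n)) (lshift n i) (rshift m j)).
    by apply/funext => v; rewrite !mxE.
  exact: cv.
have cZ : mcont (fun v : 'rV[R]_((m + n) * (m + n)) => blkZ (vec_mx v : 'M[R]_(m + n))).
  move=> i j; have -> : (fun v : 'rV[R]_((m + n) * (m + n)) => blkZ (vec_mx v : 'M[R]_(m + n)) i j) =
      (fun v => (vec_mx v : 'M[R]_(m + n)) (lshift n i) (lshift n j)).
    by apply/funext => v; rewrite !mxE.
  exact: cv.
have cc : continuous (fun v : 'rV[R]_((m + n) * (m + n)) => cost (vec_mx v)).
  have c1 := cont_tr (mcontM (mcont_cst Q2) cX).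
  have c2 := cont_tr (mcontM (mcont_cst R2) cZ).
  by move=> v; exact: cvgD (c1 v) (c2 v).
have [||||M /gP[fM _] hM] := @compact_min_mx _ _ I g cost C.
- case=> [[[[i j]|z]|x]|_] v /=.
  + exact: cvgB (cv i j v) (cv j i v).
  + exact: (cont_dot (mcont_cst z) (mcontM cv (mcont_cst z)) v).
  + exact: cvgN (cont_riccati_form cX cY v).
  + exact: cvgB (cvg_cst _) (cc v).
- exact: cc.
- by move=> M /gP[fM cM] a b; apply: hC.
- by exists M0; apply/gP.
exists M => // M' fM'; have [le|/ltW le] := lerP (cost M') (cost M0).
  by apply: hM; apply/gP.
by apply: le_trans le; apply: hM; apply/gP.
Qed.

Lemma stab_sol_riccati_form beta K X x : stab_sol beta K X -> ricq (beta ^- 2) X (K *m X) x = 0.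
Proof.
move=> [sX [/(congr1 (fun P => dot x (P *m x))) e _]]; move: e.
rewrite riccati_form_gain; move: (AK A B K) (SK Qinf Rinf K) (Wmat Bw) => F S W.
rewrite mul0mx dot0r !mulmxDl -scalemxAl -!mulmxA !dotL.
rewrite (dotMr F) (dotMr X x (F^T *m x)) (dotMr X x (S *m _)) sX.
by rewrite (dotC (X *m x) (F^T *m x)) => <-; ring.
Qed.

(** The Riccati equation is a Lyapunov inequality for the Hurwitz matrix [(AK K)^T], so [X >= 0]; on
    a kernel vector it leaves [<x, W x> = 0]. *)
Lemma stab_sol_pd beta K X : 0 < beta -> Kbeta A B Bw Qinf Rinf beta K ->
  stab_sol beta K X -> pd X.
Proof.
move=> b0 [hK _] hX; have [sX _] := hX.
have s0 : 0 < beta ^- 2 by rewrite invr_gt0 exprn_gt0.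
have S0 x : 0 <= dot x (SK Qinf Rinf K *m x) by case/psdP: (pd_psd (SK_pd pQ pR K)).
have W0 x : 0 <= dot x (Wmat Bw *m x) by case/psdP: (pd_psd pW).
have eX x : 2 * dot ((AK A B K)^T *m x) (X *m x)
     + beta ^- 2 * dot (X *m x) (SK Qinf Rinf K *m (X *m x)) + dot x (Wmat Bw *m x) = 0.
  by rewrite -riccati_form_gain stab_sol_riccati_form.
have pX : psd X.
  apply: (lyapunov_psd (hurwitz_tr hK) sX) => x.
  rewrite dotMr sX dotC; have := eX x; have := W0 x.
  have := mulr_ge0 (ltW s0) (S0 (X *m x)); lra.
apply/pdP; split=> // x x0; have /psdP[_ hX0] := pX.
rewrite lt_def hX0 andbT; apply/eqP => /(psd_quad_eq0 pX) Xx0.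
have := eX x; rewrite Xx0 mulmx0 !dot0r !mulr0 !add0r => W00.
by case/pdP: pW => _ /(_ x x0); rewrite W00 ltxx.
Qed.

(** Subtracting the equation for [X1] gives, for [D = X - X1], a Lyapunov inequality for the
    transpose of the Hurwitz matrix [F + beta^-2 X1 S], with the remainder [beta^-2 D S D] of the
    right sign. *)
Lemma stab_sol_le beta K X1 X : 0 < beta -> stab_sol beta K X1 -> X^T = X ->
  (forall x, ricq (beta ^- 2) X (K *m X) x <= 0) -> psd (X - X1).
Proof.
move=> b0 h1 sX hX; have [sX1 [_ hur]] := h1.
have s0 : 0 < beta ^- 2 by rewrite invr_gt0 exprn_gt0.
have /pdP[sS _] := SK_pd pQ pR K.
have S0 x : 0 <= dot x (SK Qinf Rinf K *m x) by case/psdP: (pd_psd (SK_pd pQ pR K)).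
have {}hX x : 2 * dot ((AK A B K)^T *m x) (X *m x)
    + beta ^- 2 * dot (X *m x) (SK Qinf Rinf K *m (X *m x)) <=
    2 * dot ((AK A B K)^T *m x) (X1 *m x)
    + beta ^- 2 * dot (X1 *m x) (SK Qinf Rinf K *m (X1 *m x)).
  have := hX x; have := stab_sol_riccati_form x h1; rewrite !riccati_form_gain => e1 e2.
  by rewrite -(lerD2r (dot x (Wmat Bw *m x))) e1.
have sD : (X - X1)^T = X - X1 by rewrite linearB /= sX sX1.
move: hX hur sS S0 {h1}.
move: (AK A B K) (SK Qinf Rinf K) => F S hX hur sS S0.
apply: (lyapunov_psd (hurwitz_tr hur)) => // x.
have -> : (F + beta ^- 2 *: (X1 *m S))^T *m x = F^T *m x + beta ^- 2 *: (S *m (X1 *m x)).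
  by rewrite linearD linearZ /= trmx_mul sS sX1 mulmxDl -scalemxAl -mulmxA.
rewrite dotMr sD; have := hX x; have := S0 ((X - X1) *m x).
rewrite !mulmxBl !mulmxBr !dotL.
rewrite (dotC (X *m x) (F^T *m x)) (dotC (X1 *m x) (F^T *m x)).
have -> : dot (X1 *m x) (S *m (X *m x)) = dot (X *m x) (S *m (X1 *m x)).
  by rewrite dotMr sS dotC.
set a := dot _ (X *m x); set a1 := dot _ (X1 *m x).
set c := dot (X *m x) (_ *m (X *m x)); set c1 := dot (X *m x) (_ *m (X1 *m x)).
set c2 := dot (X1 *m x) (_ *m (X1 *m x)) => hc e.
have := mulr_ge0 (ltW s0) hc; move: (beta ^- 2) e => s; lra.
Qed.

Lemma XK_stab_sol beta K : 0 < beta -> Kbeta A B Bw Qinf Rinf beta K ->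
  stab_sol beta K (XK A B Bw Qinf Rinf beta K).
Proof. by move=> b0 /(stab_sol_exists b0 pW pQ pR) ex; exact: (xgetPex 0 ex). Qed.

Lemma Jmix_cost beta K : 0 < beta -> Kbeta A B Bw Qinf Rinf beta K ->
  exists2 M, feas beta M & Jmix A B Bw Q2 Qinf R2 Rinf beta K = cost M.
Proof.
move=> b0 hK; have hX := XK_stab_sol b0 hK; have pX := stab_sol_pd b0 hK hX.
exists (lmi_lift (XK A B Bw Qinf Rinf beta K) (K *m XK A B Bw Qinf Rinf beta K)).
  by apply: feasible_lift => // x; rewrite stab_sol_riccati_form.
by rewrite lmi_cost_lift lmi_cost_gain.
Qed.

(** Passing from level [b] to [beta] releases [(b^-2 - beta^-2) X Qinf X], which is positive
    definite as [X] is invertible. *)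
Lemma strictly_feasible beta b K0 : 0 < b < beta -> Kbeta A B Bw Qinf Rinf b K0 ->
  exists M0 e, [/\ 0 < e, psd M0, pd (blkX M0) &
    forall x, ricq (beta ^- 2) (blkX M0) (blkY M0) x <= - e * dot x x].
Proof.
move=> /andP[bp bb] hK; have hX := XK_stab_sol bp hK; have pX := stab_sol_pd bp hK hX.
have beta0 : 0 < beta := lt_trans bp bb.
set X := XK _ _ _ _ _ _ _ in hX pX; have /pdP[sX _] := pX.
have [e e0 he] := pd_lbound (pd_congr pQ (pd_unit pX)).
have d0 : 0 < b ^- 2 - beta ^- 2.
  by rewrite subr_gt0 ltf_pV2 ?posrE ?exprn_gt0 // ltr_pXn2r // nnegrE ltW.
exists (lmi_lift X (K0 *m X)), ((b ^- 2 - beta ^- 2) * e).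
rewrite /blkX /blkY block_mxKur block_mxKdr; split=> //; first exact: mulr_gt0.
  exact: lmi_lift_psd.
move=> x; have := stab_sol_riccati_form x hX; have := he x.
have : 0 <= dot (K0 *m X *m x) (Rinf *m (K0 *m X *m x)) by case/psdP: (pd_psd pR).
rewrite /riccati_form sX -!mulmxA (dotMr X x) sX.
set r := dot (K0 *m _) _; set q := dot (X *m x) (Qinf *m _).
set u1 := dot _ (X *m x); set u2 := dot _ (K0 *m _); set w := dot x _.
move: (b ^- 2) (beta ^- 2) d0 => s s' d0 r0 hq eq0.
have := ler_wpM2l (ltW d0) hq; have := mulr_ge0 (ltW d0) r0; lra.
Qed.

Lemma mix_Kbeta beta M M0 e t : 0 < beta -> feas beta M -> 0 < e -> psd M0 ->
  pd (blkX M0) -> (forall x, ricq (beta ^- 2) (blkX M0) (blkY M0) x <= - e * dot x x) ->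
  0 < t <= 1 -> exists2 K, Kbeta A B Bw Qinf Rinf beta K &
    Jmix A B Bw Q2 Qinf R2 Rinf beta K <= (1 - t) * cost M + t * cost M0.
Proof.
move=> b0 fM e0 pM0 pX0 h0 /andP[t0 t1]; have pXM := feasible_pd pW fM; case: fM => pM hM.
have s0 : 0 < beta ^- 2 by rewrite invr_gt0 exprn_gt0.
have t1' : 0 <= 1 - t by rewrite subr_ge0.
pose Mt := (1 - t) *: M + t *: M0.
have Xt : blkX Mt = (1 - t) *: blkX M + t *: blkX M0 by apply/matrixP => i j; rewrite !mxE.
have Yt : blkY Mt = (1 - t) *: blkY M + t *: blkY M0 by apply/matrixP => i j; rewrite !mxE.
have Zt : blkZ Mt = (1 - t) *: blkZ M + t *: blkZ M0 by apply/matrixP => i j; rewrite !mxE.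
have pMt : psd Mt by apply: psdD; apply: psdZ => //; exact: ltW.
have pXt : pd (blkX Mt).
  rewrite Xt; apply: psdD_pd; last exact: pdZ.
  by apply: psdZ => //; exact: pd_psd.
have uXt := pd_unit pXt; have /pdP[sXt _] := pXt.
have ht x : ricq (beta ^- 2) (blkX Mt) (blkY Mt) x <= - (t * e) * dot x x.
  have := @riccati_form_convex _ _ _ A B Bw _ _ pQ pR (beta ^- 2) (blkX M) (blkY M)
    (blkX M0) (blkY M0) t x (ltW s0) _.
  rewrite (ltW t0) t1 -Xt -Yt => /(_ isT) /le_trans; apply.
  have := ler_wpM2l t1' (hM x); have := ler_wpM2l (ltW t0) (h0 x); rewrite mulr0; lra.
pose K := blkY Mt *m invmx (blkX Mt).
have KX : K *m blkX Mt = blkY Mt by rewrite /K mulmxKV.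
have [k k0 hk] := quad_ubound
  ((blkX Mt)^T *m Qinf *m blkX Mt + (blkY Mt)^T *m Rinf *m blkY Mt).
(* Raising [beta^-2] by [d] adds at most [d k |x|^2 = t e |x|^2], which uses up the strictness of
   the mixed point; [b] below is the level with [b^-2 = beta^-2 + d]. *)
pose d := t * e / k.
have d0 : 0 < d by rewrite divr_gt0 // mulr_gt0.
have bd0 : 0 < beta ^- 2 + d by rewrite addr_gt0.
pose b := (Num.sqrt (beta ^- 2 + d))^-1.
have b2 : b ^- 2 = beta ^- 2 + d by rewrite /b exprVn invrK sqr_sqrtr // ltW.
have bp : 0 < b by rewrite invr_gt0 sqrtr_gt0.
have bb : b < beta.
  rewrite -(@ltr_pXn2r _ 2) ?nnegrE ?(ltW bp) ?(ltW b0) //.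
  by rewrite -ltf_pV2 ?posrE ?exprn_gt0 // b2 ltrDl.
have hK : Kbeta A B Bw Qinf Rinf beta K.
  apply: (riccati_ineq_Kbeta pW pQ pR (X := blkX Mt) (b := b)) => [|//|x].
    by rewrite bp.
  have : dot (blkX Mt *m x) (Qinf *m (blkX Mt *m x)) +
         dot (blkY Mt *m x) (Rinf *m (blkY Mt *m x)) <= k * dot x x.
    have := hk x; rewrite mulmxDl -!mulmxA dotDr.
    by rewrite (dotMr (blkX Mt)^T) (dotMr (blkY Mt)^T) !trmxK.
  rewrite -riccati_form_gain KX b2; have := ht x; rewrite /riccati_form.
  set q := dot (_ *m x) (Qinf *m _); set r := dot (_ *m x) (Rinf *m _).
  set u1 := dot _ (blkX Mt *m x); set u2 := dot _ (blkY Mt *m x).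
  set w := dot x (Wmat _ *m _) => ht' /(ler_wpM2l (ltW d0)); rewrite mulrA.
  have -> : d * k = t * e by rewrite /d divfK // gt_eqF.
  by move: (beta ^- 2) (t * e) ht' => s te ht'; lra.
exists K => //.
have hX := XK_stab_sol b0 hK.
have /(psd_tr_mul _) hD : psd (blkX Mt - XK A B Bw Qinf Rinf beta K).
  apply: (stab_sol_le b0 hX sXt) => x; rewrite KX; apply: le_trans (ht x) _.
  by rewrite mulNr oppr_le0 mulr_ge0 ?dot_ge0 // mulr_ge0 // ltW.
have pN : psd (Q2 + K^T *m R2 *m K) by apply: psdD => //; exact/psd_congr/pd_psd.
have := hD _ pN; rewrite mulmxBr linearB /= subr_ge0 => /le_trans; apply.
rewrite -lmi_cost_gain // KX; apply: le_trans (lmi_cost_lb Q2 pR2 pMt pXt) _.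
rewrite /lmi_cost Xt Zt !mulmxDr -!scalemxAr !mxtraceD !mxtraceZ; lra.
Qed.

End Main.

Theorem theorem7 (R : realType) (n m : nat) (A : 'M[R]_n) (B : 'M[R]_(n, m))
  (Bw : 'M[R]_n) (Q2 Qinf : 'M[R]_n) (R2 Rinf : 'M[R]_m) (beta : R) :
  0 < beta ->
  (* Assumption 1 *)
  stabilizable A B ->
  detectable (sqrtm Q2) A ->
  (ereal_inf [set hinf_norm A B Bw Qinf Rinf K | K in Kstab A B] < beta%:E)%E ->
  (* Assumption 2 (and symmetry of the weights) *)
  psd Q2 -> pd (Wmat Bw) -> pd Qinf -> pd R2 -> pd Rinf ->
  exists (g : R) (X : 'M[R]_n) (Y : 'M[R]_(m, n)),
    Fcvx A B Bw Q2 Qinf R2 Rinf beta g X Y /\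
    (forall (g' : R) (X' : 'M[R]_n) (Y' : 'M[R]_(m, n)),
        Fcvx A B Bw Q2 Qinf R2 Rinf beta g' X' Y' -> g <= g') /\
    ereal_inf [set (Jmix A B Bw Q2 Qinf R2 Rinf beta K)%:E
                 | K in Kbeta A B Bw Qinf Rinf beta] = g%:E.
Proof.
move=> b0 _ _ hinf pQ2 pW pQ pR2 pR.
have [_ [K0 hK0 <-] hK0b] := ereal_inf_lt hinf.
(* The maximum with zero keeps [b] positive. The norm is [-oo] when [n = 0], as a supremum over the
   empty set. *)
have [b bb hb] : exists2 b, 0 < b < beta & (hinf_norm A B Bw Qinf Rinf K0 < b%:E)%E.
  case: (hinf_norm _ _ _ _ _ _) hK0b => [r| |] //.
    rewrite lte_fin => rb; exists ((Num.max 0 r + beta) / 2).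
      have : Num.max 0 r < beta by rewrite gt_max b0.
      have : 0 <= Num.max 0 r by rewrite le_max lexx.
      by move=> ? ?; apply/andP; split; lra.
    have : Num.max 0 r < beta by rewrite gt_max b0.
    have : r <= Num.max 0 r by rewrite le_max lexx orbT.
    by rewrite lte_fin; lra.
  by move=> _; exists (beta / 2); [apply/andP; split; lra | exact: ltNyr].
have [M0 [e [e0 pM0 pX0 h0]]] := strictly_feasible pW pQ pR bb (conj hK0 hb).
have fM0 : feasible A B Bw Qinf Rinf beta M0.
  split=> // x; apply: le_trans (h0 x) _.
  by rewrite mulNr oppr_le0 mulr_ge0 ?dot_ge0 // ltW.
have [M fM hM] := min_cost_attained pQ2 pW pQ pR2 pR b0 (ex_intro _ M0 fM0).
exists (lmi_cost Q2 R2 M), (blkX M), (blkY M); split; first exact: feasible_Fcvx.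
split=> [g' X' Y' /(Fcvx_feasible b0 pW pQ pR)[fL]|]; first by apply: le_trans; exact: hM.
apply/le_anti/andP; split; last first.
  apply: le_ereal_inf_tmp => _ [K hK <-]; rewrite lee_fin.
  have [M' fM' ->] := Jmix_cost Q2 R2 pW pQ pR b0 hK; exact: hM.
apply/lee_addgt0Pr => eps eps0.
pose D := lmi_cost Q2 R2 M0 - lmi_cost Q2 R2 M.
have D0 : 0 <= D by rewrite subr_ge0 hM.
(* Small enough for [t D <= eps]; the [+ 1] covers [D = 0]. *)
pose t := Num.min 1 (eps / (D + 1)).
have D1 : 0 < D + 1 by apply: ltr_wpDl.
have t01 : 0 < t <= 1 by rewrite lt_min ltr01 divr_gt0 //= ge_min lexx.
have [K hK hJ] := mix_Kbeta pQ2 pW pQ pR2 pR b0 fM e0 pM0 pX0 h0 t01.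
apply: (@le_trans _ _ (Jmix A B Bw Q2 Qinf R2 Rinf beta K)%:E).
  by apply: ereal_inf_lbound; exists K.
rewrite -EFinD lee_fin; apply: le_trans hJ _.
have tD : t * D <= eps.
  apply: (@le_trans _ _ (t * (D + 1))); first by rewrite ler_pM2l ?lerDl //; case/andP: t01.
  by rewrite -ler_pdivlMr // ge_min lexx orbT.
by move: tD; rewrite /D; lra.
Qed.
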